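(* Let $k$ be a field which is not algebraic over a finite field and let $\alpha\in k$ be an element of infinite multiplicative order. Let $R=k[V,X,Y,Z]/I$, where $I$ is the ideal generated by $$V^2,\ Z^2,\ XY,\ VX+\alpha XZ,\ VY+YZ,\ VX+Y^2,\ VY-X^2,$$ and let $v,x,y,z$ denote the residue classes of $V,X,Y,Z$ in $R$. For each integer $s\ge 1$ let $M_s$ be the cokernel of the $R$-linear map $d_{-s}\colon R^2\to R^2$ given, with respect to the standard basis of $R^2$ (matrices acting on column vectors), by the matrix $$\begin{pmatrix} v & \alpha^{s}x\\ y & z\end{pmatrix}.$$ Then for every integer $s\ge 1$ and every nonzero integer $i$: (1) $M_s$ satisfies $(\mathsf{TR}_i)$ if and only if $i<s$; (2) $\operatorname{Tr}(M_s)$ satisfies $(\mathsf{TR}_i)$ if and only if $i>-s$.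
   Context: For a finite (i.e. finitely generated) module $M$ over a commutative Noetherian ring $R$, choose a homomorphism $\phi\colon G\to F$ of finite free $R$-modules with $M=\operatorname{Coker}\phi$; the transpose of $M$ is $\operatorname{Tr}(M):=\operatorname{Coker}(\phi^* )$, where $\phi^*=\operatorname{Hom}_R(\phi,R)\colon F^*\to G^*$. It is unique up to projective equivalence (i.e. up to adding projective direct summands), so the vanishing of $\operatorname{Ext}^j_R(\operatorname{Tr}(M),R)$ for $j\geq 1$ does not depend on the choice of $\phi$. For a nonzero integer $i$, the finite $R$-module $M$ is said to satisfy condition $(\mathsf{TR}_i)$ provided $\operatorname{Ext}^i_R(M,R)=0$ if $i\ge 1$, and provided $\operatorname{Ext}^{-i}_R(\operatorname{Tr}(M),R)=0$ if $i\le -1$. No condition $(\mathsf{TR}_0)$ is defined; it is always assumed tacitly that $i\neq 0$. *)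

(* Defs.v *)
From HB Require Import structures.
From mathcomp Require Import all_boot all_order all_algebra.
From mathcomp Require Import freeg mpoly.
From mathcomp Require Import boolp.

Set Implicit Arguments.
Unset Strict Implicit.
Unset Printing Implicit Defensive.

Import GRing.Theory.

Local Open Scope ring_scope.
Local Open Scope quotient_scope.

Section Modules.
Variable R : nzRingType.

Definition surj (M N : lmodType R) (f : M -> N) := forall y, exists x, f x = y.

Definition lmod_iso (M N : lmodType R) :=
  exists f : {linear M -> N}, bijective f.

Definition exact_at (L M N : lmodType R) (f : L -> M) (g : M -> N) :=
  forall x, g x = 0 <-> exists y, f y = x.

Definition projective (P : lmodType R) :=
  forall (M N : lmodType R) (g : {linear M -> N}) (f : {linear P -> N}),
    surj g -> exists h : {linear P -> M}, forall x, g (h x) = f x.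

Record projective_resolution (M : lmodType R) := ProjectiveResolution {
  res_obj : nat -> lmodType R;
  res_diff : forall n, {linear res_obj n.+1 -> res_obj n};
  res_aug : {linear res_obj 0 -> M};
  res_projective : forall n, projective (res_obj n);
  res_aug_surj : surj res_aug;
  res_exact0 : exact_at (res_diff 0) res_aug;
  res_exact : forall n, exact_at (res_diff n.+1) (res_diff n)
}.

Section Kernel.
Variables (M N : lmodType R) (g : {linear M -> N}).

Definition ker_pred : {pred M} := fun x => g x == 0.

Fact ker_submod_closed : submod_closed ker_pred.
Proof.
split=> [|a u v]; rewrite !unfold_in ?linear0 // => /eqP gu /eqP gv.
by rewrite linearP gu gv scaler0 addr0.
Qed.

HB.instance Definition _ :=
  GRing.isSubmodClosed.Build R M ker_pred ker_submod_closed.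

Record ker := Ker { ker_val :> M; _ : ker_val \in ker_pred }.
HB.instance Definition _ := [isSub for ker_val].
HB.instance Definition _ := [Choice of ker by <:].
HB.instance Definition _ := [SubChoice_isSubLmodule of ker by <:].

End Kernel.

Section FreeLift.
Variables (K : choiceType) (M : lmodType R) (f : K -> M).

HB.instance Definition _ :=
  GRing.isZmodMorphism.Build {freeg K / R} M (fglift f) (lift_is_additive f).

Fact fglift_scalable : scalable (fglift f).
Proof.
move=> c D; rewrite -[D in RHS]freeg_sumE.
transitivity (fglift f (fgscale c D)) => //; rewrite /fgscale !raddf_sum /=.
by apply: eq_bigr => x _; rewrite !liftU scalerA.
Qed.

HB.instance Definition _ :=
  GRing.isScalable.Build R {freeg K / R} M *:%R (fglift f) fglift_scalable.

End FreeLift.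

Lemma freeg_projective (K : choiceType) : projective {freeg K / R}.
Proof.
move=> M N g f g_surj.
have ex y : exists x, g x == y by have [x <-] := g_surj y; exists x.
exists (fglift (fun x : K => xchoose (ex (f << x >>)))) => D.
rewrite -[D]freeg_sumE !raddf_sum; apply: eq_bigr => x _ /=.
rewrite liftU linearZ (eqP (xchooseP (ex _))) -linearZ; congr (f _).
apply/eqP/freeg_eqP => y; by rewrite coeffZ !coeffU mul1r.
Qed.

Definition free_cover (M : lmodType R) : {linear {freeg M / R} -> M} :=
  fglift (@id M).

Lemma free_cover_surj M : surj (free_cover M).
Proof. by move=> x; exists << x >>; rewrite /free_cover /= liftU scale1r. Qed.

Definition syzygy (n : nat) (M : lmodType R) : lmodType R :=
  iter n (fun N => ker (free_cover N) : lmodType R) M.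

Lemma projective_resolution_exists (M : lmodType R) :
  inhabited (projective_resolution M).
Proof.
pose d n : {linear {freeg (syzygy n.+1 M) / R} -> {freeg (syzygy n M) / R}} :=
  (\val : {linear ker (free_cover (syzygy n M)) -> _})
    \o free_cover (syzygy n.+1 M).
have dE n : exact_at (d n) (free_cover (syzygy n M)).
  move=> x; split=> [/eqP xK | [y <-]].
    have [y yx] := @free_cover_surj (syzygy n.+1 M) (Ker xK).
    by exists y; rewrite /d /= yx.
  exact/eqP/(valP (free_cover (syzygy n.+1 M) y : ker (free_cover (syzygy n M)))).
exists; apply: (@ProjectiveResolution M (fun n => {freeg (syzygy n M) / R}) d
  (free_cover M)) => [n||//|n x].
- exact: freeg_projective.
- exact: free_cover_surj.
- exact: dE.
- rewrite -dE /d /=; split=> [|->]; last exact: (linear0 \val).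
  by move=> h; apply: val_inj; exact: h.
Qed.

End Modules.

Section Ext.
Variables (R : comNzRingType) (M N : lmodType R).

Definition cocycle (P : projective_resolution M) i
    (f : {linear res_obj P i -> N}) :=
  forall x, f (res_diff P i x) = 0.

Definition coboundary (P : projective_resolution M) i :
    {linear res_obj P i -> N} -> Prop :=
  match i with
  | 0 => fun f => forall x, f x = 0
  | j.+1 => fun f =>
      exists g : {linear res_obj P j -> N}, forall x, f x = g (res_diff P j x)
  end.

(* [Ext_eq0 i] is the vanishing of the [i]-th cohomology of [Hom(P, N)].  The
   choice of [P] is immaterial, and [projective_resolution_exists] shows that
   the quantification over [P] is never vacuous. *)
Definition Ext_eq0 (i : nat) :=
  forall (P : projective_resolution M) (f : {linear res_obj P i -> N}),
    cocycle f -> coboundary f.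

End Ext.

Section Cokernel.
Variables (R : comNzRingType) (m n : nat) (A : 'M[R]_(m, n)).

Definition im_mx : {pred 'cV[R]_m} := fun u => `[< exists w, u = A *m w >].

Fact im_mx_zmod_closed : zmod_closed im_mx.
Proof.
split; first by apply/asboolP; exists 0; rewrite mulmx0.
move=> u v /asboolP[w ->] /asboolP[z ->]; apply/asboolP.
by exists (w - z); rewrite mulmxBr.
Qed.

HB.instance Definition _ := GRing.isZmodClosed.Build _ im_mx im_mx_zmod_closed.

Definition coker := Quotient.quot im_mx.
HB.instance Definition _ := GRing.Zmodule.on coker.

Definition coker_pi (u : 'cV[R]_m) : coker := \pi u.

Lemma coker_piP u v : coker_pi u = coker_pi v <-> exists w, u - v = A *m w.
Proof.
rewrite /coker_pi; split=> [/eqP|h].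
  by rewrite -Quotient.idealrBE => /asboolP.
by apply/eqP; rewrite -Quotient.idealrBE; apply/asboolP.
Qed.

Lemma coker_pi_repr x : coker_pi (repr x) = x. Proof. exact: reprK. Qed.

Definition coker_scale (a : R) (x : coker) := coker_pi (a *: repr x).

Lemma coker_piZ a u : coker_pi (a *: u) = coker_scale a (coker_pi u).
Proof.
have [w e] : exists w, u - repr (coker_pi u) = A *m w.
  by apply/coker_piP; rewrite coker_pi_repr.
by apply/coker_piP; exists (a *: w); rewrite -scalerBr e scalemxAr.
Qed.

Lemma coker_piD u v : coker_pi (u + v) = coker_pi u + coker_pi v.
Proof. exact: raddfD. Qed.

Fact coker_scaleA a b x :
  coker_scale a (coker_scale b x) = coker_scale (a * b) x.
Proof. by rewrite -[x]coker_pi_repr -!coker_piZ scalerA. Qed.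

Fact coker_scale1 : left_id 1 coker_scale.
Proof. by move=> x; rewrite -[x]coker_pi_repr -coker_piZ scale1r. Qed.

Fact coker_scaleDr : right_distributive coker_scale +%R.
Proof.
move=> a x y; rewrite -[x]coker_pi_repr -[y]coker_pi_repr -coker_piD.
by rewrite -!coker_piZ scalerDr coker_piD.
Qed.

Fact coker_scaleDl x : {morph coker_scale^~ x : a b / a + b}.
Proof.
by move=> a b; rewrite -[x]coker_pi_repr -!coker_piZ scalerDl coker_piD.
Qed.

HB.instance Definition _ := GRing.Zmodule_isLmodule.Build R coker
  coker_scaleA coker_scale1 coker_scaleDr coker_scaleDl.

End Cokernel.

Section ConditionTR.
Variable R : comNzRingType.

(* [T] is a possible value of Tr(M).  A map phi : R^n -> R^m is given by its
   matrix [A] acting on columns; in the dual bases phi^* has matrix [A^T]. *)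
Definition is_transpose (T M : lmodType R) :=
  exists m n (A : 'M[R]_(m, n)),
    lmod_iso (coker A) M /\ lmod_iso (coker A^T) T.

(* [Negz j] is the integer - (j + 1).  The value at 0, where the condition is
   not defined, is meaningless. *)
Definition TR (i : int) (M : lmodType R) : Prop :=
  match i with
  | Posz j => Ext_eq0 M R^o j
  | Negz j => forall T, is_transpose T M -> Ext_eq0 T R^o j.+1
  end.

End ConditionTR.

Definition algebraic_over_finite_field (k : fieldType) :=
  exists (F : finFieldType) (iota : {rmorphism F -> k}),
    forall x : k, algebraicOver iota x.

Definition infinite_order (k : fieldType) (a : k) :=
  a != 0 /\ forall n, (0 < n)%N -> a ^+ n != 1.

Definition ideal_gen (A : comNzRingType) (gs : seq A) : {pred A} := fun p =>
  `[< exists c : 'I_(size gs) -> A, p = \sum_i c i * gs`_i >].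

Section RingR.
Variables (k : fieldType) (alpha : k).

Local Notation V := ('X_(@Ordinal 4 0 isT) : {mpoly k[4]}).
Local Notation X := ('X_(@Ordinal 4 1 isT) : {mpoly k[4]}).
Local Notation Y := ('X_(@Ordinal 4 2 isT) : {mpoly k[4]}).
Local Notation Z := ('X_(@Ordinal 4 3 isT) : {mpoly k[4]}).

Definition relators : seq {mpoly k[4]} :=
  [:: V ^+ 2; Z ^+ 2; X * Y; V * X + alpha *: (X * Z);
      V * Y + Y * Z; V * X + Y ^+ 2; V * Y - X ^+ 2].

Definition ideal_I : {pred {mpoly k[4]}} := ideal_gen relators.

Fact ideal_I_closed : idealr_closed ideal_I.
Proof.
split.
- by apply/asboolP; exists (fun=> 0); rewrite big1 // => i _; rewrite mul0r.
- apply/asboolP => -[c /(congr1 (meval (fun=> 0)))]; apply/eqP.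
  rewrite meval1 raddf_sum big1 ?oner_eq0 // => i _ /=.
  have /allP/(_ _ (mem_nth 0 (ltn_ord i)))/eqP :
      all (fun g : {mpoly k[4]} => g.@[fun=> 0] == 0) relators.
    rewrite /= !expr2 !(mevalD, mevalN, mevalZ, mevalM, mevalXU).
    by rewrite !(mulr0, addr0, oppr0, eqxx).
  by rewrite mevalM => ->; rewrite mulr0.
- move=> a u v /asboolP[c ->] /asboolP[d ->]; apply/asboolP.
  exists (fun i => a * c i + d i); rewrite mulr_sumr -big_split /=.
  by apply: eq_bigr => i _; rewrite mulrDl mulrA.
Qed.

HB.instance Definition _ := isIdealr.Build _ ideal_I ideal_I_closed.

Definition ringR : comNzRingType := {ideal_quot ideal_I}.

Definition residue (p : {mpoly k[4]}) : ringR := \pi_{ideal_quot ideal_I} p.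

(* The matrix of the map d_{-s}. *)
Definition d_neg (s : nat) : 'M[ringR]_2 :=
  \matrix_(i, j)
    if i == 0 then if j == 0 then residue V else residue (alpha ^+ s *: X)
    else if j == 0 then residue Y else residue Z.

Definition M_ (s : nat) : lmodType ringR := coker (d_neg s).

End RingR.

(* Main.v *)
From HB Require Import structures.
Require Import Defs.
From mathcomp Require Import all_boot all_order all_algebra.
From mathcomp Require Import zify ring.
From mathcomp Require Import mpoly.
From mathcomp Require Import boolp.

(** The ring [R] has the [k]-basis [1, v, x, y, z, vz, xz, yz]: the relations
    express every quadratic monomial through [vz], [xz], [yz] and kill every
    cubic one, so it is graded with pieces of dimension 1, 4, 3. Write [d(q)]
    for the matrix with rows [(v, qx)] and [(y, z)]; then [M_s] is the cokernel
    of [d(alpha^s)], and the relation [vx + alpha xz = 0] gives [d(alpha q)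
    d(q) = 0].

    Linear algebra in degrees 1 and 2 (a map from an 8-dimensional space to a
    6-dimensional one) shows that the image of [d(q)] contains the whole of
    degree 2 unless [alpha q = 1], and that the image of its transpose does
    unless [q = 1]. Counting dimensions, [ker d(alpha q) = im d(q)] as long as
    [alpha q] and [alpha^2 q] differ from 1 ([dmx_exact]), and for the
    transposes [ker d(q)^T = im d(alpha q)^T] as long as [q] and [alpha q]
    differ from 1 ([dmx_trmx_exact]). As [alpha] has infinite order, the
    [d(alpha^s)] with [s] running down to 0 begin a free resolution of [M_s],
    whose dual first fails to be exact in degree [s]; and the transposes, with
    [s] running up, resolve the transpose of [M_s], and their dual is exact in
    all positive degrees. In terms of single modules: the syzygy of [M_(s+1)]
    is [M_s] for [s >= 0], and [Ext^1(M_(s+1), R)] vanishes for [s >= 1] but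
    not for [s = 0] ([Ext_coker_dmx]); the syzygies of the transposes run in
    the other direction ([Ext_coker_dmx_trmx]).

    What remains is that [Ext^i(M_0, R)] is nonzero for every [i >= 1]
    ([Ext_coker_dmx1_neq0]). The kernel of [d(1)], which is the second syzygy
    of [M_0], is the image of [d(1/alpha)] plus one more element [(0, xz)] of
    the socle; as that element is annihilated by the maximal ideal, the residue
    field [k] is a direct summand of this syzygy. The degrees 1 and 2 are
    settled by explicit cocycles.

    So it is enough that [Ext^i(k, R)] is nonzero for all [i >= 1]. The
    annihilator of [v] is [(v)], so [R/(v)] has a periodic resolution whose
    dual is exact, and [v] times the maximal ideal is the whole of degree 2, so
    that the maximal ideal modulo [(v)] is [k^3]. The exact sequence [0 -> k^3
    -> R/(v) -> k -> 0] therefore turns the vanishing of [Ext^(i+1)(k, R)] into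
    that of [Ext^i(k^3, R)], and one descends to [i = 1], where a cocycle is
    written down ([Ext_residue_field_neq0]).

    The homological input is elementary: splicing resolutions gives dimension
    shift ([Ext_shift], [Ext1_extend]), lifting chain maps shows that Ext in
    positive degrees passes to a module that is a retract up to a projective
    ([stable_retract_Ext]), and the mapping cone of a chain map gives the piece
    of the long exact sequence used above ([Ext_first_term]). The retract
    statement has three uses: the choice of the resolution, the direct
    summands, and the fact that two presentations of one module have stably
    isomorphic transposes ([Ext_coker_trmx]), which frees the conditions on
    transposes from the choice of a presentation.

    All computations are carried out in a model of [R] with explicit
    coordinates and are transported along an isomorphism. *)

Set Implicit Arguments.
Unset Strict Implicit.
Unset Printing Implicit Defensive.

Import Order.TTheory GRing.Theory Num.Theory.

Local Open Scope ring_scope.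

(** * Projective resolutions and vanishing of Ext *)

Arguments res_aug_surj {R M} p y.
Arguments res_exact0 {R M} p x.
Arguments res_exact {R M} p n x.
Arguments res_projective {R M} p n _ _ _ _ _.

Section Resolutions.
Variable R : comNzRingType.

Definition linear_of (U V : lmodType R) (f : U -> V) (f_lin : linear f) :
    {linear U -> V} :=
  HB.pack f (GRing.isLinear.Build R U V *:%R f f_lin).

(** Projectivity only concerns surjections, so both maps are first corestricted
    to the kernel of [e], onto which [d] is surjective. *)
Lemma projective_lift (P L M N : lmodType R) (d : {linear L -> M})
    (e : {linear M -> N}) (f : {linear P -> M}) :
    projective P -> exact_at d e -> (forall x, e (f x) = 0) ->
  exists h : {linear P -> L}, forall x, d (h x) = f x.
Proof.
move=> projP ex ef0.
have dK x : d x \in ker_pred e by rewrite unfold_in; apply/eqP/ex; exists x.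
have fK x : f x \in ker_pred e by rewrite unfold_in; apply/eqP.
have d_lin : linear (fun x => Ker (dK x)).
  by move=> a u v; apply: val_inj; rewrite /= linearP.
have f_lin : linear (fun x => Ker (fK x)).
  by move=> a u v; apply: val_inj; rewrite /= linearP.
have d_surj : surj (linear_of d_lin).
  case=> y yK; have /ex[x xy] : e y = 0 by apply/eqP.
  by exists x; apply: val_inj.
have [h hP] := projP _ _ _ (linear_of f_lin) d_surj.
by exists h => x; have /(congr1 val) := hP x.
Qed.

Fact pairl_linear (P Q : lmodType R) : linear (fun x : P => (x, 0 : Q)).
Proof.
by move=> c u v; apply: injective_projections; rewrite //= scaler0 addr0.
Qed.

Fact pairr_linear (P Q : lmodType R) : linear (fun x : Q => (0 : P, x)).
Proof.
by move=> c u v; apply: injective_projections; rewrite //= scaler0 addr0.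
Qed.

Definition pairl (P Q : lmodType R) : {linear P -> (P * Q)%type} :=
  linear_of (@pairl_linear P Q).
Definition pairr (P Q : lmodType R) : {linear Q -> (P * Q)%type} :=
  linear_of (@pairr_linear P Q).

Lemma projective_prod (P Q : lmodType R) :
  projective P -> projective Q -> projective (P * Q)%type.
Proof.
move=> projP projQ M N g f gs.
have [h hP] := projP _ _ g (f \o pairl P Q) gs.
have [l lP] := projQ _ _ g (f \o pairr P Q) gs.
exists ((h \o fst) \+ (l \o snd)) => -[x y] /=.
rewrite linearD hP lP /= -linearD; congr (f _).
by apply: injective_projections; rewrite //= ?addr0 ?add0r.
Qed.

Section Splice.
Variables (K P M : lmodType R) (i : {linear K -> P}) (p : {linear P -> M}).
Hypotheses (projP : projective P) (i_inj : injective i) (ex : exact_at i p)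
  (p_surj : surj p).
Variable Q : projective_resolution K.

Definition splice_obj n : lmodType R := if n is m.+1 then res_obj Q m else P.

Definition splice_diff n : {linear splice_obj n.+1 -> splice_obj n} :=
  match n with
  | 0 => i \o res_aug Q
  | m.+1 => res_diff Q m
  end.

Lemma splice_projective n : projective (splice_obj n).
Proof. by case: n => [|n] //=; apply: res_projective. Qed.

Lemma splice_exact0 : exact_at (splice_diff 0) p.
Proof.
move=> x; rewrite ex; split=> [[y <-]|[y <-]]; last by exists (res_aug Q y).
by have [z <-] := res_aug_surj Q y; exists z.
Qed.

Lemma splice_exact n : exact_at (splice_diff n.+1) (splice_diff n).
Proof.
case: n => [|n] x /=; last exact: res_exact.
rewrite -(res_exact0 Q); split=> [|->]; last by rewrite linear0.
by rewrite -(linear0 i) => /i_inj.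
Qed.

(** A resolution of the first syzygy [K], with [P] put in front, resolves [M]:
    its cocycles in degree [j + 1] are those of the resolution of [K] in degree
    [j]. *)
Definition splice : projective_resolution M :=
  ProjectiveResolution splice_projective p_surj splice_exact0 splice_exact.

End Splice.

Lemma res_diff_aug (M : lmodType R) (P : projective_resolution M) x :
  res_aug P (res_diff P 0 x) = 0.
Proof. by apply/res_exact0; exists x. Qed.

Lemma res_diff_diff (M : lmodType R) (P : projective_resolution M) n x :
  res_diff P n (res_diff P n.+1 x) = 0.
Proof. by apply/res_exact; exists x. Qed.

Arguments res_diff_aug {M} P x.
Arguments res_diff_diff {M} P n x.

Section ChainMap.
Variables (M L : lmodType R) (P : projective_resolution M)
  (Q : projective_resolution L) (a : {linear M -> L}).

Record chain_map := ChainMap {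
  chain : forall n, {linear res_obj P n -> res_obj Q n};
  chain_aug : forall x, res_aug Q (chain 0 x) = a (res_aug P x);
  chain_diff : forall n x,
    res_diff Q n (chain n.+1 x) = chain n (res_diff P n x)
}.

(** Lifting one degree needs the lift in the two previous degrees to commute
    with the differentials; the recursion therefore runs on commuting pairs of
    consecutive components. *)
Lemma chain_map_exists : inhabited chain_map.
Proof.
have [u0 u0P] := res_projective P 0 _ _ (res_aug Q) (a \o res_aug P)
  (res_aug_surj Q).
have [u1 u1P] : exists u1 : {linear res_obj P 1 -> res_obj Q 1},
    forall x, res_diff Q 0 (u1 x) = (u0 \o res_diff P 0) x.
  apply: projective_lift (res_projective P 1) (res_exact0 Q) _ => x /=.
  by rewrite u0P /= res_diff_aug linear0.
pose T n := {u : {linear res_obj P n -> res_obj Q n} *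
                 {linear res_obj P n.+1 -> res_obj Q n.+1} |
              forall x, res_diff Q n (u.2 x) = u.1 (res_diff P n x)}.
have next n (u : T n) : {v : T n.+1 | (sval v).1 = (sval u).2}.
  case: u => -[u u'] /= uP; apply: cid.
  have [w wP] : exists w : {linear res_obj P n.+2 -> res_obj Q n.+2},
      forall x, res_diff Q n.+1 (w x) = (u' \o res_diff P n.+1) x.
    apply: projective_lift (res_projective P n.+2) (res_exact Q n) _.
    by move=> x /=; rewrite uP /= res_diff_diff linear0.
  by exists (exist _ (u', w) wP).
pose t := nat_rect T (exist _ (u0, u1) u1P) (fun n u => sval (next n u)).
split; exists (fun n => (sval (t n)).1) => [x|n x] /=; first exact: u0P.
by rewrite (svalP (next n (t n))) (svalP (t n)).
Qed.

End ChainMap.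

(** In positive degrees Ext does not see projectives: [id = b a + q p] with [q
    p] factoring through a projective [F] makes [Ext^(j+1)(M, N)] a retract of
    [Ext^(j+1)(L, N)]. On resolutions, [q p] lifts to a map that vanishes on
    the images of the differentials, so in positive degrees the composite [w u]
    of the lifts of [a] and [b] is homotopic to the identity. Vanishing is
    assumed for a single resolution [Q] of [L] and obtained for all resolutions
    of [M]; the case [L = M] is the independence of the resolution. *)
Lemma stable_retract_Ext (M L F N : lmodType R)
    (a : {linear M -> L}) (b : {linear L -> M})
    (p : {linear M -> F}) (q : {linear F -> M}) (Q : projective_resolution L)
    j :
    projective F -> (forall x, b (a x) + q (p x) = x) ->
    (forall f : {linear res_obj Q j.+1 -> N}, cocycle f -> coboundary f) ->
  Ext_eq0 M N j.+1.
Proof.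
move=> projF idE Q0 P f fco.
have [u] := chain_map_exists P Q a; have [w] := chain_map_exists Q P b.
(* Only the fact that [id - w u - s d] takes values in cycles is carried along:
   it is what lifting [s] to the next degree needs. *)
have homotopy n : exists s : {linear res_obj P n -> res_obj P n.+1}, forall x,
    res_diff P n (x - chain w n.+1 (chain u n.+1 x) - s (res_diff P n x)) = 0.
  elim: n => [|n [s sP]].
    have [q' q'P] := projF _ _ (res_aug P) q (res_aug_surj P).
    have [s sP] : exists s : {linear res_obj P 0 -> res_obj P 1},
        forall x, res_diff P 0 (s x) =
          (idfun \- (chain w 0 \o chain u 0) \- (q' \o (p \o res_aug P))) x.
      apply: projective_lift (res_projective P 0) (res_exact0 P) _.
      move=> x /=; rewrite !linearB chain_aug chain_aug q'P.
      rewrite -{1}(idE (res_aug P x)).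
      by rewrite -addrA -opprD subrr.
    exists s => x; rewrite !linearB !chain_diff sP /=.
    by rewrite res_diff_aug (linear0 p) (linear0 q') subr0 subrr.
  have [s' s'P] : exists s' : {linear res_obj P n.+1 -> res_obj P n.+2},
      forall x, res_diff P n.+1 (s' x) =
        (idfun \- (chain w n.+1 \o chain u n.+1) \- (s \o res_diff P n)) x.
    apply: projective_lift (res_projective P n.+1) (res_exact P n) _ => x.
    exact: sP.
  exists s' => x; rewrite !linearB !chain_diff s'P /=.
  by rewrite res_diff_diff (linear0 s) subr0 subrr.
have [s sP] := homotopy j.
have [g gP] : coboundary (f \o chain w j.+1).
  by apply: Q0 => x /=; rewrite -chain_diff fco.
exists ((g \o chain u j) \+ (f \o s)) => x /=; rewrite -chain_diff -gP /=.
have /(res_exact P)[y yP] := sP x.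
have := fco y; rewrite yP !linearB -addrA -opprD => /eqP.
by rewrite subr_eq0 => /eqP.
Qed.

Lemma projective_zero : projective 'cV[R]_0.
Proof.
move=> M N g f gs; exists \0 => x.
by rewrite !linear0 [x]flatmx0 linear0.
Qed.

Lemma retract_Ext (M L N : lmodType R) (a : {linear M -> L})
    (b : {linear L -> M}) j :
  (forall x, b (a x) = x) -> Ext_eq0 L N j.+1 -> Ext_eq0 M N j.+1.
Proof.
move=> ab L0; have [Q] := projective_resolution_exists L.
apply: (@stable_retract_Ext _ _ _ _ a b (\0 : {linear M -> 'cV[R]_0}) \0 Q).
- exact: projective_zero.
- by move=> x; rewrite ab /= addr0.
- exact: L0.
Qed.

Lemma lmod_iso_sym (M N : lmodType R) : lmod_iso M N -> lmod_iso N M.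
Proof.
by case=> f [g fK gK]; exists (linear_of (can2_linear fK gK)), f.
Qed.

Lemma lmod_iso_trans (L M N : lmodType R) :
  lmod_iso L M -> lmod_iso M N -> lmod_iso L N.
Proof. by case=> f f_bij [g g_bij]; exists (g \o f); apply: bij_comp. Qed.

Lemma Ext_iso (M L N : lmodType R) j :
  lmod_iso M L -> Ext_eq0 L N j.+1 -> Ext_eq0 M N j.+1.
Proof.
case=> f [g fK gK].
exact: (retract_Ext (a := f) (b := linear_of (can2_linear fK gK))).
Qed.

Section DimensionShift.
Variables (K P M N : lmodType R) (i : {linear K -> P}) (p : {linear P -> M}).
Hypotheses (projP : projective P) (i_inj : injective i) (ex : exact_at i p)
  (p_surj : surj p).

(** To test vanishing of Ext on [M], a resolution that begins with [P] is
    enough. *)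
Lemma Ext_of_splice (Q : projective_resolution K) j :
    (forall f : {linear res_obj (splice projP i_inj ex p_surj Q) j.+1 -> N},
       cocycle f -> coboundary f) ->
  Ext_eq0 M N j.+1.
Proof.
apply: (@stable_retract_Ext _ _ _ _ idfun idfun (\0 : {linear M -> 'cV[R]_0})
  \0) => [|x]; first exact: projective_zero.
by rewrite /= addr0.
Qed.

Lemma Ext_shift j : Ext_eq0 M N j.+2 <-> Ext_eq0 K N j.+1.
Proof.
split=> [M0 Q f fco|K0]; first exact: (M0 (splice projP i_inj ex p_surj Q)).
have [Q] := projective_resolution_exists K.
by apply: (@Ext_of_splice Q) => f fco; apply: (K0 Q).
Qed.

Lemma Ext1_extend : Ext_eq0 M N 1 <->
  forall f : {linear K -> N}, exists g : {linear P -> N},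
    forall x, f x = g (i x).
Proof.
have [Q] := projective_resolution_exists K; split=> [M0 f|extend].
  have [|g gP] := M0 (splice projP i_inj ex p_surj Q) (f \o res_aug Q).
    by move=> x /=; rewrite res_diff_aug linear0.
  by exists g => x; have [y <-] := res_aug_surj Q x; rewrite -gP.
apply: (@Ext_of_splice Q) => f fco /=.
have sec y : {x | res_aug Q x = y} by apply: cid; apply: res_aug_surj.
have fE x y : res_aug Q x = res_aug Q y -> f x = f y.
  move=> /eqP; rewrite -subr_eq0 -linearB => /eqP/(res_exact0 Q)[z zE].
  by apply/eqP; rewrite -subr_eq0 -linearB -zE; apply/eqP/fco.
have lin : linear (fun y => f (sval (sec y))).
  move=> c y z; rewrite -linearP; apply: fE; rewrite linearP.
  by rewrite !(svalP (sec _)).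
have [g gP] := extend (linear_of lin); exists g => x /=.
by rewrite -gP; apply: fE; rewrite (svalP (sec _)).
Qed.

End DimensionShift.

Section Cone.
Variables (A B C : lmodType R) (i : {linear A -> B}) (g : {linear B -> C}).
Hypotheses (i_inj : injective i) (ex : exact_at i g) (g_surj : surj g).
Variables (Q : projective_resolution A) (P : projective_resolution B)
  (u : chain_map Q P i).

Definition cone_obj n : lmodType R :=
  if n is m.+1 then (res_obj P m.+1 * res_obj Q m)%type else res_obj P 0.

Fact cone_diff0_linear : linear (fun x : cone_obj 1 =>
  (res_diff P 0 x.1 + chain u 0 x.2 : cone_obj 0)).
Proof. by move=> c x y; rewrite /= !linearP scalerDr addrACA. Qed.

Fact cone_diffS_linear n : linear (fun x : cone_obj n.+2 =>
  ((res_diff P n.+1 x.1 + chain u n.+1 x.2, - res_diff Q n x.2) :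
     cone_obj n.+1)).
Proof.
move=> c x y; rewrite /= !linearP; apply: injective_projections => //=.
by rewrite scalerDr addrACA.
Qed.

Definition cone_diff n : {linear cone_obj n.+1 -> cone_obj n} :=
  match n with
  | 0 => linear_of cone_diff0_linear
  | m.+1 => linear_of (@cone_diffS_linear m)
  end.

Definition cone_aug : {linear cone_obj 0 -> C} := g \o res_aug P.

Lemma cone_projective n : projective (cone_obj n).
Proof.
case: n => [|n]; first exact: res_projective.
by apply: projective_prod; apply: res_projective.
Qed.

Lemma cone_aug_surj : surj cone_aug.
Proof.
move=> z; have [y <-] := g_surj z; have [x <-] := res_aug_surj P y.
by exists x.
Qed.

Lemma cone_exact0 : exact_at (cone_diff 0) cone_aug.
Proof.
move=> x; rewrite /cone_aug /=; split=> [/ex[a aE]|[[y z] /= <-]].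
  have [q qE] := res_aug_surj Q a.
  have /(res_exact0 P)[y yE] : res_aug P (x - chain u 0 q) = 0.
    by rewrite linearB chain_aug qE aE subrr.
  by exists (y, q); rewrite /= yE subrK.
rewrite linearD res_diff_aug add0r chain_aug.
by apply/ex; exists (res_aug Q z).
Qed.

Lemma cone_exact n : exact_at (cone_diff n.+1) (cone_diff n).
Proof.
case: n => [|n] [x y] /=; split.
- move=> xy0; have yE : res_aug Q y = 0.
    apply: i_inj; rewrite linear0 -(chain_aug u) -[LHS]add0r.
    by rewrite -{1}(res_diff_aug P x) -linearD xy0 linear0.
  have /(res_exact0 Q)[z zE] : res_aug Q (- y) = 0 by rewrite linearN yE oppr0.
  have /(res_exact P)[w wE] : res_diff P 0 (x - chain u 1 z) = 0.
    by rewrite linearB chain_diff zE linearN opprK.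
  by exists (w, z); rewrite /= wE zE opprK subrK.
- case=> -[w z] /= [<- <-].
  by rewrite linearD res_diff_diff add0r chain_diff linearN subrr.
- case=> xy0 /eqP; rewrite oppr_eq0 => /eqP y0.
  have /(res_exact Q)[z zE] : res_diff Q n (- y) = 0.
    by rewrite linearN y0 oppr0.
  have /(res_exact P)[w wE] : res_diff P n.+1 (x - chain u n.+2 z) = 0.
    by rewrite linearB chain_diff zE linearN opprK.
  by exists (w, z); rewrite /= wE zE opprK subrK.
- case=> -[w z] /= [<- <-]; apply: injective_projections => /=.
    by rewrite linearD res_diff_diff add0r chain_diff linearN subrr.
  by rewrite linearN opprK res_diff_diff.
Qed.

(** The mapping cone of a lift [u] of [i : A -> B] resolves the cokernel [C] of
    [i]: an element of the kernel in the lowest degree comes from [A], and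
    [i_inj] makes the class in [A] of a cycle of the cone vanish. *)
Definition cone : projective_resolution C :=
  ProjectiveResolution cone_projective cone_aug_surj cone_exact0 cone_exact.

End Cone.

(** The map [Ext^(j+1)(A, N) -> Ext^(j+2)(C, N)] of the long exact sequence has
    kernel covered by [Ext^(j+1)(B, N)]. A cocycle on [Q] becomes a cocycle on
    the cone; if that is the coboundary of [h], the component of [h] on the
    resolution of [B] is a cocycle, hence a coboundary, and subtracting it
    leaves a cochain on [Q] with the right coboundary. *)
Lemma Ext_first_term (A B C N : lmodType R) (i : {linear A -> B})
    (g : {linear B -> C}) j :
    injective i -> exact_at i g -> surj g ->
  Ext_eq0 B N j.+1 -> Ext_eq0 C N j.+2 -> Ext_eq0 A N j.+1.
Proof.
move=> i_inj ex g_surj B0 C0 Q f fco.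
have [P] := projective_resolution_exists B.
have [u] := chain_map_exists Q P i.
pose T := cone i_inj ex g_surj u.
(* The shift of the cone onto the resolution of [A] makes [f] a cocycle. *)
have [|h hE] := C0 T (f \o snd : {linear res_obj T j.+2 -> N}).
  by move=> x /=; rewrite linearN fco oppr0.
have [x|w wE] := B0 P (h \o pairl _ _).
  by have := hE (x, 0); rewrite /= !linear0 addr0 => <-.
exists ((w \o chain u j) \- (h \o pairr _ _)) => x /=.
rewrite -chain_diff -wE /=.
have := hE (0, x); rewrite /= linear0 add0r => ->.
rewrite -linearB; congr (h _).
by apply: injective_projections; rewrite //= ?subr0 ?sub0r.
Qed.

End Resolutions.

(** * Cokernels of matrices *)

Section Cokernels.
Variable R : comNzRingType.

Definition mx_exact m n p (A : 'M[R]_(m, n)) (B : 'M[R]_(n, p)) :=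
  forall u : 'cV[R]_n, A *m u = 0 <-> exists w : 'cV[R]_p, u = B *m w.

(** Every linear form on the image of [A] extends to the ambient free module: a
    row that vanishes on the kernel of [A] is such a form. *)
Definition coexact m n (A : 'M[R]_(m, n)) := forall r : 'rV[R]_n,
  (forall u : 'cV[R]_n, A *m u = 0 -> r *m u = 0) ->
  exists t : 'rV[R]_m, r = t *m A.

Definition mulmx_lin m n p (A : 'M[R]_(m, n)) :
  {linear 'M[R]_(n, p) -> 'M[R]_(m, p)} := mulmx A.

Lemma projective_cV n : projective 'cV[R]_n.
Proof.
move=> M N g f gs.
have sec i : {x | g x = f (delta_mx i 0)} by apply: cid; apply: gs.
have lin : linear (fun u : 'cV[R]_n => \sum_i u i 0 *: sval (sec i)).
  move=> c u v; rewrite scaler_sumr -big_split; apply: eq_bigr => i _ /=.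
  by rewrite !mxE scalerDl scalerA.
exists (linear_of lin) => u /=; rewrite linear_sum [u in RHS]matrix_sum_delta.
rewrite linear_sum; apply: eq_bigr => i _.
by rewrite big_ord1 !linearZ (svalP (sec i)).
Qed.

Lemma coker_pi_is_linear m n (A : 'M[R]_(m, n)) : linear (coker_pi A).
Proof. by move=> c u v; rewrite coker_piD coker_piZ. Qed.

HB.instance Definition _ m n (A : 'M[R]_(m, n)) :=
  GRing.isLinear.Build R 'cV[R]_m (coker A) *:%R (coker_pi A)
    (@coker_pi_is_linear m n A).

Lemma coker_pi_surj m n (A : 'M[R]_(m, n)) : surj (coker_pi A).
Proof. by move=> x; exists (repr x); apply: coker_pi_repr. Qed.

Lemma coker_pi_eq0 m n (A : 'M[R]_(m, n)) u :
  coker_pi A u = 0 <-> exists w, u = A *m w.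
Proof.
rewrite -(linear0 (coker_pi A)); split=> [/coker_piP|[w uE]].
  by rewrite subr0.
by apply/coker_piP; exists w; rewrite subr0.
Qed.

Lemma coker_piM m n (A : 'M[R]_(m, n)) w : coker_pi A (A *m w) = 0.
Proof. by apply/coker_pi_eq0; exists w. Qed.

Lemma coker_desc m n (A : 'M[R]_(m, n)) (N : lmodType R)
    (f : {linear 'cV[R]_m -> N}) :
    (forall w, f (A *m w) = 0) ->
  {g : {linear coker A -> N} | forall u, g (coker_pi A u) = f u}.
Proof.
move=> fA; pose g (x : coker A) := f (repr x).
have gE u : g (coker_pi A u) = f u.
  have /coker_pi_eq0[w wE] : coker_pi A (repr (coker_pi A u) - u) = 0.
    by apply/eqP; rewrite linearB subr_eq0; apply/eqP/coker_pi_repr.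
  by apply/eqP; rewrite -subr_eq0 /g -linearB wE fA.
have lin : linear g.
  move=> c x y; have [u <-] := coker_pi_surj x.
  by have [v <-] := coker_pi_surj y; rewrite -linearP !gE linearP.
by exists (linear_of lin).
Qed.

Lemma coker_map m n p q (A : 'M[R]_(m, n)) (B : 'M[R]_(p, q))
    (U : 'M[R]_(p, m)) (V : 'M[R]_(q, n)) :
    U *m A = B *m V ->
  {g : {linear coker A -> coker B} |
     forall u, g (coker_pi A u) = coker_pi B (U *m u)}.
Proof.
move=> UAE; apply: (@coker_desc _ _ A _ (coker_pi B \o mulmx_lin 1 U)) => w /=.
by rewrite mulmxA UAE -mulmxA; apply: coker_piM.
Qed.

Lemma coker_mul m n p (A : 'M[R]_(m, n)) (B : 'M[R]_(n, p)) :
    mx_exact A B ->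
  {i : {linear coker B -> 'cV[R]_m} |
     [/\ forall u, i (coker_pi B u) = A *m u, injective i
       & exact_at i (coker_pi A)]}.
Proof.
move=> AB; have [|i iE] := @coker_desc _ _ B _ (mulmx_lin 1 A).
  by move=> w; apply/AB; exists w.
exists i; split=> // [x y|u].
  have [v <-] := coker_pi_surj x; have [w <-] := coker_pi_surj y.
  rewrite !iE => /eqP; rewrite -subr_eq0 -linearB => /eqP/AB/coker_pi_eq0.
  by rewrite linearB => /eqP; rewrite subr_eq0 => /eqP.
rewrite coker_pi_eq0; split=> [[w ->]|[y <-]].
  by exists (coker_pi B w).
by have [w <-] := coker_pi_surj y; exists w.
Qed.

(** The syzygy of [coker A] is the image of [A], which is [coker B]. *)
Lemma Ext_coker_shift m n p (A : 'M[R]_(m, n)) (B : 'M[R]_(n, p)) j :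
  mx_exact A B ->
  Ext_eq0 (coker A) R^o j.+2 <-> Ext_eq0 (coker B) R^o j.+1.
Proof.
move=> /coker_mul[i [_ i_inj ex]].
exact: (Ext_shift _ (@projective_cV m) i_inj ex (@coker_pi_surj _ _ A)).
Qed.

Lemma linear_form n (f : {linear 'cV[R]_n -> R^o}) :
  {r : 'rV[R]_n | forall u, f u = (r *m u) 0 0}.
Proof.
exists (\row_i f (delta_mx i 0)) => u.
rewrite [u in LHS]matrix_sum_delta linear_sum mxE; apply: eq_bigr => i _.
by rewrite big_ord1 linearZ mxE mulrC.
Qed.

Lemma row_form_linear n (r : 'rV[R]_n) :
  linear (fun u : 'cV[R]_n => (r *m u) 0 0 : R^o).
Proof. by move=> c u v; rewrite mulmxDr -scalemxAr !mxE. Qed.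

Lemma row_form_inj n (r t : 'rV[R]_n) :
  (forall u : 'cV[R]_n, r *m u = t *m u) -> r = t.
Proof.
move=> rt; apply/rowP => i; have := rt (delta_mx i 0).
by rewrite -!colE => /matrixP/(_ 0 0); rewrite !mxE.
Qed.

Lemma Ext1_coker m n (A : 'M[R]_(m, n)) :
  Ext_eq0 (coker A) R^o 1 <-> coexact A.
Proof.
pose K := ker (coker_pi A); pose i : {linear K -> 'cV[R]_m} := \val.
have ex : exact_at i (coker_pi A).
  move=> u; split=> [/eqP uK|[[y yK] <-]]; last exact/eqP/yK.
  by exists (Ker uK).
have AK w : coker_pi A (A *m w) == 0 by rewrite coker_piM.
have KA (y : K) : {w | y = Ker (AK w)}.
  apply: cid; have /coker_pi_eq0[w wE] := eqP (valP y).
  by exists w; apply: val_inj.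
rewrite (Ext1_extend _ (@projective_cV m) val_inj ex (@coker_pi_surj _ _ A)).
split=> [extend r rA|coA f].
  pose f (y : K) : R^o := (r *m sval (KA y)) 0 0.
  have fE w : f (Ker (AK w)) = (r *m w) 0 0.
    have /(congr1 val)/= /eqP := svalP (KA (Ker (AK w))).
    rewrite -subr_eq0 -mulmxBr => /eqP/rA; rewrite mulmxBr => /eqP.
    by rewrite subr_eq0 /f => /eqP->.
  have lin : linear f.
    move=> c x y; rewrite (svalP (KA x)) (svalP (KA y)) !fE.
    rewrite -row_form_linear -fE; congr f; apply: val_inj.
    by rewrite /= mulmxDr scalemxAr.
  have [g gP] := extend (linear_of lin).
  have [t tE] := linear_form g; exists t; apply: row_form_inj => u.
  apply/matrixP => a b; rewrite !ord1 -fE [LHS](gP _) tE.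
  by rewrite mulmxA.
have lin : linear (fun w => f (Ker (AK w))).
  move=> c u v; rewrite -linearP; congr (f _); apply: val_inj.
  by rewrite /= mulmxDr scalemxAr.
have [r rE] := linear_form (linear_of lin).
have [u Au0|t tE] := coA r.
  apply/matrixP => a b; rewrite !ord1 -rE /= mxE -(linear0 f); congr (f _).
  exact: val_inj.
exists (linear_of (@row_form_linear _ t)) => y /=.
by rewrite (svalP (KA y)) [LHS](rE _) tE mulmxA.
Qed.

Lemma coker_lift m p q (B : 'M[R]_(p, q)) (h : {linear 'cV[R]_m -> coker B}) :
  {U : 'M[R]_(p, m) | forall u, h u = coker_pi B (U *m u)}.
Proof.
have sec i : {u | coker_pi B u = h (delta_mx i 0)}.
  by apply: cid; apply: coker_pi_surj.
exists (\matrix_(a, i) sval (sec i) a 0) => u.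
rewrite [u in LHS]matrix_sum_delta linear_sum.
have -> : (\matrix_(a, i) sval (sec i) a 0) *m u =
          \sum_i u i 0 *: sval (sec i).
  apply/colP => a; rewrite mxE summxE; apply: eq_bigr => i _.
  by rewrite !mxE mulrC.
rewrite linear_sum; apply: eq_bigr => i _.
by rewrite big_ord1 !linearZ; congr (_ *: _); exact/esym/(svalP (sec i)).
Qed.

Lemma coker_factor m p q (B : 'M[R]_(p, q)) (U : 'M[R]_(p, m)) :
  (forall u, coker_pi B (U *m u) = 0) -> {V : 'M[R]_(q, m) | U = B *m V}.
Proof.
move=> UB; have sec i : {w | U *m (delta_mx i 0 : 'cV_m) = B *m w}.
  by apply: cid; exact/(coker_pi_eq0 B)/UB.
have [w wE] : {w | forall i, U *m (delta_mx i 0 : 'cV_m) = B *m w i}.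
  by exists (fun i => sval (sec i)) => i; exact: (svalP (sec i)).
exists (\matrix_(a, i) w i a 0); apply/matrixP => a i.
have /matrixP/(_ a 0) := wE i; rewrite -colE !mxE => ->.
by apply: eq_bigr => j _; rewrite mxE.
Qed.

Lemma coker_lift_iso m n p q (A : 'M[R]_(m, n)) (B : 'M[R]_(p, q))
    (f : {linear coker A -> coker B}) :
  {U : 'M[R]_(p, m) & {V : 'M[R]_(q, n) |
    (forall u, f (coker_pi A u) = coker_pi B (U *m u)) /\ U *m A = B *m V}}.
Proof.
have [U UE] := coker_lift (f \o coker_pi A).
have [|V VE] := @coker_factor n _ _ B (U *m A).
  by move=> u; rewrite -mulmxA -UE /= coker_piM linear0.
by exists U, V; split=> // u; rewrite -UE.
Qed.

(** Lift the isomorphism and its inverse to the presentations: [U] and [W] on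
    the generators, [V] and [Z] on the relations. Then [V Z] is the identity up
    to [H B], which is invisible on [coker B^T], and a matrix [K] with [B K =
    0]. The transpose of [K] factors through a free module on [coker B^T], so
    the latter is a retract of [coker A^T] up to a projective. *)
Lemma Ext_coker_trmx m n p q (A : 'M[R]_(m, n)) (B : 'M[R]_(p, q)) j :
    lmod_iso (coker A) (coker B) ->
  Ext_eq0 (coker A^T) R^o j.+1 -> Ext_eq0 (coker B^T) R^o j.+1.
Proof.
case=> f [g fK gK] A0.
have [U [V [UE UA]]] := coker_lift_iso f.
have [W [Z [WE WB]]] := coker_lift_iso (linear_of (can2_linear fK gK)).
have [u|H HE] := @coker_factor p _ _ B (U *m W - 1%:M).
  rewrite mulmxBl mul1mx -mulmxA linearB /= -UE -WE /= gK subrr; exact: erefl.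
pose K := V *m Z - 1%:M - H *m B.
have BK : B *m K = 0.
  rewrite !mulmxBr mulmx1 !mulmxA -UA -HE -mulmxA -WB mulmxA mulmxBl mul1mx.
  by rewrite subrr.
have [|a aE] := @coker_map _ _ _ _ B^T A^T V^T U^T.
  by rewrite -!trmx_mul UA.
have [|b bE] := @coker_map _ _ _ _ A^T B^T Z^T W^T.
  by rewrite -!trmx_mul WB.
have [|k kE] := @coker_desc _ _ B^T _ (mulmx_lin 1 (- K^T)).
  by move=> w; rewrite /= mulmxA mulNmx -trmx_mul BK trmx0 oppr0 mul0mx.
have [P] := projective_resolution_exists (coker A^T).
apply: (@stable_retract_Ext _ _ _ _ _ a b k (coker_pi B^T) P).
- exact: projective_cV.
- move=> x; have [u <-] := coker_pi_surj x.
  rewrite aE bE kE -linearD /= mulmxA -mulmxDl -trmx_mul -linearB /=.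
  have -> : V *m Z = K + (1%:M + H *m B).
    by rewrite /K -(addrA (V *m Z)) -opprD subrK.
  rewrite addrC addKr linearD /= trmx1 mulmxDl mul1mx trmx_mul -mulmxA.
  by rewrite linearD /= coker_piM addr0.
- exact: A0.
Qed.

Lemma Ext_coker_block m n p q (A : 'M[R]_(m, n)) (B : 'M[R]_(p, q)) j :
  Ext_eq0 (coker (block_mx A 0 0 B)) R^o j.+1 -> Ext_eq0 (coker B) R^o j.+1.
Proof.
have [|a aE] := @coker_map _ _ _ _ B (block_mx A 0 0 B)
  (col_mx 0 1%:M) (col_mx 0 1%:M).
  by rewrite mul_col_mx mul_block_col !mul0mx !mulmx0 mul1mx mulmx1 !add0r.
have [|b bE] := @coker_map _ _ _ _ (block_mx A 0 0 B) B
  (row_mx 0 1%:M) (row_mx 0 1%:M).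
  by rewrite mul_row_block mul_mx_row !mul0mx !mulmx0 mul1mx mulmx1 !add0r.
apply: (retract_Ext (a := a) (b := b)) => x.
have [u <-] := coker_pi_surj x.
by rewrite aE bE mulmxA mul_row_col mul0mx mul1mx add0r mul1mx.
Qed.

End Cokernels.

Definition in_im (R : comNzRingType) m n (A : 'M[R]_(m, n)) (u : 'cV[R]_m) :=
  exists w : 'cV[R]_n, u = A *m w.

(** A row that vanishes on [ker A] vanishes on the columns of [B], so its
    transpose lies in the kernel of [B^T], that is, in the image of [A^T]. *)
Lemma coexact_trmx (R : comNzRingType) m n p (A : 'M[R]_(m, n))
    (B : 'M[R]_(n, p)) :
  A *m B = 0 -> mx_exact B^T A^T -> coexact A.
Proof.
move=> AB ex r rA; have rB : r *m B = 0.
  apply: row_form_inj => w; rewrite -mulmxA mul0mx; apply: rA.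
  by rewrite mulmxA AB mul0mx.
have /ex[t tE] : B^T *m r^T = 0 by rewrite -trmx_mul rB trmx0.
by exists t^T; rewrite -[LHS]trmxK tE trmx_mul trmxK.
Qed.

Lemma in_im_block (R : comNzRingType) m n p q (A : 'M[R]_(m, n))
    (B : 'M[R]_(p, q)) u1 u2 :
  in_im (block_mx A 0 0 B) (col_mx u1 u2) <-> in_im A u1 /\ in_im B u2.
Proof.
split=> [[w]|[[w1 ->] [w2 ->]]].
  rewrite -[w]vsubmxK mul_block_col !mul0mx addr0 add0r => /eq_col_mx[-> ->].
  by split; [exists (usubmx w) | exists (dsubmx w)].
by exists (col_mx w1 w2); rewrite mul_block_col !mul0mx addr0 add0r.
Qed.

(** The hypotheses say that [U] induces an injection of [coker A] into [coker
    B] whose cokernel is [coker C], presented on the generators of [coker B].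
    *)
Lemma Ext_coker_first_term (R : comNzRingType) m n p q r (A : 'M[R]_(m, n))
    (B : 'M[R]_(p, q)) (C : 'M[R]_(p, r)) (U : 'M[R]_(p, m)) j :
    (forall u, in_im A u <-> in_im B (U *m u)) ->
    (forall u, in_im C u <-> exists t, in_im B (u - U *m t)) ->
  Ext_eq0 (coker B) R^o j.+1 -> Ext_eq0 (coker C) R^o j.+2 ->
  Ext_eq0 (coker A) R^o j.+1.
Proof.
move=> AB BC.
have [|i iE] := @coker_desc _ _ _ A _ (coker_pi B \o mulmx_lin 1 U).
  by move=> w; apply/coker_pi_eq0/AB; exists w.
have [|g gE] := @coker_desc _ _ _ B _ (coker_pi C).
  move=> w; apply/coker_pi_eq0/BC; exists 0.
  by rewrite mulmx0 subr0; exists w.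
apply: (Ext_first_term (i := i) (g := g)).
- move=> x y; have [u <-] := coker_pi_surj x; have [w <-] := coker_pi_surj y.
  rewrite !iE => /eqP; rewrite -subr_eq0 -linearB /= => /eqP/coker_pi_eq0.
  move=> /AB/coker_pi_eq0; rewrite linearB => /eqP.
  by rewrite subr_eq0 => /eqP.
- move=> x; have [u <-] := coker_pi_surj x; rewrite gE.
  split=> [/coker_pi_eq0/BC[t /coker_pi_eq0]|[y]].
    rewrite linearB /= => /eqP; rewrite subr_eq0 => /eqP uE.
    by exists (coker_pi A t); rewrite iE.
  have [t <-] := coker_pi_surj y; rewrite iE /= => /coker_piP[w wE].
  apply/coker_pi_eq0/BC; exists t; exists (- w).
  by rewrite mulmxN -wE opprB.
- move=> x; have [u <-] := coker_pi_surj x; exists (coker_pi B u).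
  by rewrite gE.
Qed.

Section Transport.
Variables (S R : comNzRingType) (f : {rmorphism S -> R}).
Hypotheses (f_inj : injective f) (f_surj : forall r, exists s, f s = r).

Lemma map_mx_surj m n (A : 'M[R]_(m, n)) : {B | A = map_mx f B}.
Proof.
have sec r : {s | f s = r} by apply: cid.
exists (\matrix_(i, j) sval (sec (A i j))); apply/matrixP => i j.
by rewrite !mxE (svalP (sec _)).
Qed.

Lemma map_matrix_inj m n (A B : 'M[S]_(m, n)) :
  map_mx f A = map_mx f B -> A = B.
Proof.
move=> /matrixP AB; apply/matrixP => i j; apply: f_inj.
by have := AB i j; rewrite !mxE.
Qed.

Lemma in_im_map m n (A : 'M[S]_(m, n)) u :
  in_im (map_mx f A) (map_mx f u) <-> in_im A u.
Proof.
split=> [[w]|[w ->]]; last by exists (map_mx f w); rewrite map_mxM.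
have [v ->] := map_mx_surj w; rewrite -map_mxM => /(map_matrix_inj)->.
by exists v.
Qed.

Lemma mx_exact_map m n p (A : 'M[S]_(m, n)) (B : 'M[S]_(n, p)) :
  mx_exact A B -> mx_exact (map_mx f A) (map_mx f B).
Proof.
move=> AB u; have [v ->] := map_mx_surj u.
rewrite -map_mxM -(map_mx0 f); split=> [/(map_matrix_inj)/AB|].
  by move/in_im_map.
by move=> /in_im_map/AB->.
Qed.

Lemma coexact_map m n (A : 'M[S]_(m, n)) : coexact (map_mx f A) <-> coexact A.
Proof.
split=> coA r rA.
  have [u Au|t] := coA (map_mx f r).
    have [v vE] := map_mx_surj u; move: Au.
    rewrite {u}vE -!map_mxM -(map_mx0 f).
    by move/(map_matrix_inj)/rA->; rewrite map_mx0.
  have [v ->] := map_mx_surj t; rewrite -map_mxM => /(map_matrix_inj)->.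
  by exists v.
have [r0 rE] := map_mx_surj r; have [u Au|t tE] := coA r0.
  apply: (map_matrix_inj); rewrite map_mxM -rE rA ?map_mx0 //.
  by rewrite -map_mxM Au map_mx0.
by exists (map_mx f t); rewrite -map_mxM -tE.
Qed.

End Transport.

(** * A model of the ring *)

(** The coordinates with respect to [1, v, x, y, z, vz, xz, yz]. The parameter
    [alpha] only enters through the multiplication; it is part of the type so
    that every [alpha] has its own ring structure. *)
Record model (k : fieldType) (alpha : k) := Model {
  c1 : k; cv : k; cx : k; cy : k; cz : k; cvz : k; cxz : k; cyz : k }.

Section ModelRing.
Variables (k : fieldType) (alpha : k).
Local Notation S := (model alpha).
Local Notation Mk := (@Model k alpha).

Lemma modelP (s t : S) :
  c1 s = c1 t -> cv s = cv t -> cx s = cx t -> cy s = cy t -> cz s = cz t ->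
  cvz s = cvz t -> cxz s = cxz t -> cyz s = cyz t -> s = t.
Proof. by case: s; case: t => /= *; congr Model. Qed.

Definition model_code (s : S) :=
  (c1 s, cv s, cx s, cy s, cz s, cvz s, cxz s, cyz s).
Definition model_decode (u : k * k * k * k * k * k * k * k) : S :=
  let: (t, v, x, y, z, a, b, c) := u in Mk t v x y z a b c.
Lemma model_codeK : cancel model_code model_decode. Proof. by case. Qed.

HB.instance Definition _ := Choice.copy S (can_type model_codeK).

Definition model0 := Mk 0 0 0 0 0 0 0 0.
Definition model1 := Mk 1 0 0 0 0 0 0 0.
Definition model_opp (s : S) := Mk (- c1 s) (- cv s) (- cx s) (- cy s) (- cz s)
  (- cvz s) (- cxz s) (- cyz s).
Definition model_add (s t : S) := Mk (c1 s + c1 t) (cv s + cv t) (cx s + cx t)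
  (cy s + cy t) (cz s + cz t) (cvz s + cvz t) (cxz s + cxz t) (cyz s + cyz t).
(** The multiplication table in degree 2 is [v^2 = z^2 = xy = 0], [vx = - alpha
    xz], [y^2 = alpha xz], [vy = x^2 = - yz]; cubic products vanish. *)
Definition model_mul (s t : S) := Mk (c1 s * c1 t)
  (c1 s * cv t + cv s * c1 t) (c1 s * cx t + cx s * c1 t)
  (c1 s * cy t + cy s * c1 t) (c1 s * cz t + cz s * c1 t)
  (c1 s * cvz t + cvz s * c1 t + cv s * cz t + cz s * cv t)
  (c1 s * cxz t + cxz s * c1 t + cx s * cz t + cz s * cx t
     - alpha * (cv s * cx t + cx s * cv t) + alpha * cy s * cy t)
  (c1 s * cyz t + cyz s * c1 t + cy s * cz t + cz s * cy t
     - (cv s * cy t + cy s * cv t) - cx s * cx t).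

Fact model_addA : associative model_add.
Proof. by move=> s t u; apply: modelP => /=; ring. Qed.
Fact model_addC : commutative model_add.
Proof. by move=> s t; apply: modelP => /=; ring. Qed.
Fact model_add0 : left_id model0 model_add.
Proof. by move=> s; apply: modelP => /=; ring. Qed.
Fact model_addN : left_inverse model0 model_opp model_add.
Proof. by move=> s; apply: modelP => /=; ring. Qed.

HB.instance Definition _ :=
  GRing.isZmodule.Build S model_addA model_addC model_add0 model_addN.

Fact model_mulA : associative model_mul.
Proof. by move=> s t u; apply: modelP => /=; ring. Qed.
Fact model_mulC : commutative model_mul.
Proof. by move=> s t; apply: modelP => /=; ring. Qed.
Fact model_mul1 : left_id model1 model_mul.
Proof. by move=> s; apply: modelP => /=; ring. Qed.
Fact model_mulDl : left_distributive model_mul model_add.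
Proof. by move=> s t u; apply: modelP => /=; ring. Qed.
Fact model_1neq0 : model1 != 0.
Proof. by apply/eqP => /(congr1 (@c1 _ _))/eqP /=; rewrite oner_eq0. Qed.

HB.instance Definition _ := GRing.Zmodule_isComNzRing.Build S
  model_mulA model_mulC model_mul1 model_mulDl model_1neq0.

Definition model_const (t : k) : S := Mk t 0 0 0 0 0 0 0.
Definition model_v : S := Mk 0 1 0 0 0 0 0 0.
Definition model_x : S := Mk 0 0 1 0 0 0 0 0.
Definition model_y : S := Mk 0 0 0 1 0 0 0 0.
Definition model_z : S := Mk 0 0 0 0 1 0 0 0.

Fact model_const_zmod : zmod_morphism model_const.
Proof. by move=> s t; apply: modelP => /=; ring. Qed.
Fact model_const_monoid : monoid_morphism model_const.
Proof. by split=> // s t; apply: modelP => /=; ring. Qed.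
HB.instance Definition _ :=
  GRing.isZmodMorphism.Build k S model_const model_const_zmod.
HB.instance Definition _ :=
  GRing.isMonoidMorphism.Build k S model_const model_const_monoid.

Section Eval.
Variables (A : comNzRingType) (iota : {rmorphism k -> A}) (v x y z : A).

Definition model_eval (s : S) : A :=
  iota (c1 s) + (iota (cv s) * v + iota (cx s) * x + iota (cy s) * y
     + iota (cz s) * z)
  + (iota (cvz s) * (v * z) + iota (cxz s) * (x * z) + iota (cyz s) * (y * z)).

Hypotheses (vv : v * v = 0) (zz : z * z = 0) (xy : x * y = 0)
  (vx : v * x = - (iota alpha * (x * z))) (vy : v * y = - (y * z))
  (yy : y * y = iota alpha * (x * z)) (xx : x * x = - (y * z)).

Lemma model_eval_zmod : zmod_morphism model_eval.
Proof. by move=> s t; rewrite /model_eval /= !rmorphD !rmorphN; ring. Qed.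

(** The seven relations in [A] reproduce the table in degree 2, and they
    already force all cubic monomials to vanish: each is a multiple of [z^2] or
    [xy]. *)
Lemma model_eval_monoid : monoid_morphism model_eval.
Proof.
split=> [|s t].
  by rewrite /model_eval /= !rmorph0 rmorph1 !mul0r !addr0.
have [vvz xvz yvz zvz] : [/\ v * (v * z) = 0, x * (v * z) = 0,
    y * (v * z) = 0 & z * (v * z) = 0].
  split; first by rewrite mulrA vv mul0r.
  - have -> : x * (v * z) = v * x * z by ring.
    by rewrite vx mulNr -!mulrA zz !mulr0 oppr0.
  - have -> : y * (v * z) = v * y * z by ring.
    by rewrite vy mulNr -!mulrA zz !mulr0 oppr0.
  - by rewrite mulrCA zz mulr0.
have [vxz xxz yxz zxz] : [/\ v * (x * z) = 0, x * (x * z) = 0,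
    y * (x * z) = 0 & z * (x * z) = 0].
  split; first by rewrite mulrA vx mulNr -!mulrA zz !mulr0 oppr0.
  - by rewrite mulrA xx mulNr -!mulrA zz !mulr0 oppr0.
  - by rewrite mulrA (mulrC y) xy mul0r.
  - by rewrite mulrCA zz mulr0.
have [vyz xyz yyz zyz] : [/\ v * (y * z) = 0, x * (y * z) = 0,
    y * (y * z) = 0 & z * (y * z) = 0].
  split; first by rewrite mulrA vy mulNr -!mulrA zz !mulr0 oppr0.
  - by rewrite mulrA xy mul0r.
  - by rewrite mulrA yy -!mulrA zz !mulr0.
  - by rewrite mulrCA zz mulr0.
pose lin (s : S) := iota (cv s) * v + iota (cx s) * x + iota (cy s) * y
  + iota (cz s) * z.
pose quad (s : S) := iota (cvz s) * (v * z) + iota (cxz s) * (x * z)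
  + iota (cyz s) * (y * z).
have lq s1 s2 : lin s1 * quad s2 = 0.
  rewrite /lin /quad.
  transitivity
    (iota (cv s1) * (iota (cvz s2) * (v * (v * z))
      + iota (cxz s2) * (v * (x * z)) + iota (cyz s2) * (v * (y * z)))
    + iota (cx s1) * (iota (cvz s2) * (x * (v * z))
      + iota (cxz s2) * (x * (x * z)) + iota (cyz s2) * (x * (y * z)))
    + iota (cy s1) * (iota (cvz s2) * (y * (v * z))
      + iota (cxz s2) * (y * (x * z)) + iota (cyz s2) * (y * (y * z)))
    + iota (cz s1) * (iota (cvz s2) * (z * (v * z))
      + iota (cxz s2) * (z * (x * z))
      + iota (cyz s2) * (z * (y * z)))); first by ring.
  by rewrite vvz xvz yvz zvz vxz xxz yxz zxz vyz xyz yyz zyz !(mulr0, addr0).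
have qq s1 s2 : quad s1 * quad s2 = 0.
  have -> : quad s1 =
    (iota (cvz s1) * v + iota (cxz s1) * x + iota (cyz s1) * y) * z
    by rewrite /quad; ring.
  have -> : quad s2 =
    (iota (cvz s2) * v + iota (cxz s2) * x + iota (cyz s2) * y) * z
    by rewrite /quad; ring.
  by rewrite mulrACA zz mulr0.
have ll : lin s * lin t = iota (cv s * cz t + cz s * cv t) * (v * z)
  + iota (cx s * cz t + cz s * cx t - alpha * (cv s * cx t + cx s * cv t)
      + alpha * cy s * cy t) * (x * z)
  + iota (cy s * cz t + cz s * cy t - (cv s * cy t + cy s * cv t)
      - cx s * cx t) * (y * z).
  rewrite !(rmorphD, rmorphN, rmorphB, rmorphM) /lin /=.
  move: (iota (cv s)) (iota (cx s)) (iota (cy s)) (iota (cz s))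
    (iota (cv t)) (iota (cx t)) (iota (cy t)) (iota (cz t)) => a b c d e f g h.
  transitivity (a * e * (v * v) + b * f * (x * x) + c * g * (y * y)
    + d * h * (z * z) + (a * f + b * e) * (v * x) + (a * g + c * e) * (v * y)
    + (a * h + d * e) * (v * z) + (b * g + c * f) * (x * y)
    + (b * h + d * f) * (x * z) + (c * h + d * g) * (y * z)); first by ring.
  by rewrite vv xx yy zz vx vy xy; ring.
have E (u : S) : model_eval u = iota (c1 u) + lin u + quad u by [].
rewrite !E.
transitivity (iota (c1 s) * iota (c1 t)
  + (iota (c1 s) * lin t + lin s * iota (c1 t))
  + (iota (c1 s) * quad t + quad s * iota (c1 t) + lin s * lin t)
  + (lin s * quad t + lin t * quad s) + quad s * quad t); last by ring.
rewrite lq lq qq ll addr0 addr0 addr0 /lin /quad /=.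
by rewrite !(rmorphD, rmorphN, rmorphM) /=; ring.
Qed.

End Eval.

End ModelRing.

(** * The model is isomorphic to the quotient of the polynomial ring *)

(** A polynomial ring is generated by the constants and the variables. *)
Lemma mpoly_rmorphism_ext n (K A : comNzRingType)
    (f g : {rmorphism {mpoly K[n]} -> A}) :
    (forall c, f c%:MP = g c%:MP) -> (forall i, f 'X_i = g 'X_i) ->
  f =1 g.
Proof.
move=> fgC fgX p; rewrite (mpolyE p) !rmorph_sum; apply: eq_bigr => m _.
rewrite -mul_mpolyC !rmorphM fgC; congr (_ * _).
rewrite mpolyXE_id !rmorph_prod; apply: eq_bigr => i _.
by rewrite !rmorphXn fgX.
Qed.

Section ModelIso.
Variables (k : fieldType) (alpha : k).
Local Notation S := (model alpha).
Local Notation R := (ringR alpha).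

Local Notation V := ('X_(@Ordinal 4 0 isT) : {mpoly k[4]}).
Local Notation X := ('X_(@Ordinal 4 1 isT) : {mpoly k[4]}).
Local Notation Y := ('X_(@Ordinal 4 2 isT) : {mpoly k[4]}).
Local Notation Z := ('X_(@Ordinal 4 3 isT) : {mpoly k[4]}).

Fact residue_zmod : zmod_morphism (@residue k alpha).
Proof. by move=> p q; rewrite /residue raddfB. Qed.
Fact residue_monoid : monoid_morphism (@residue k alpha).
Proof. by split=> [|p q]; rewrite /residue ?rmorph1 ?rmorphM. Qed.
HB.instance Definition _ :=
  GRing.isZmodMorphism.Build _ R (@residue k alpha) residue_zmod.
HB.instance Definition _ :=
  GRing.isMonoidMorphism.Build _ R (@residue k alpha) residue_monoid.

Lemma residueP p q : residue alpha p = residue alpha q <->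
  p - q \in ideal_I alpha.
Proof.
by split=> [/eqP|h]; last apply/eqP; rewrite -Quotient.idealrBE.
Qed.

Lemma residue_relator p : p \in relators alpha -> residue alpha p = 0.
Proof.
move=> /(nthP 0)[i i_lt <-]; rewrite -(rmorph0 (residue alpha)).
apply/residueP; rewrite subr0; apply/asboolP.
exists (fun j => (j == Ordinal i_lt)%:R); rewrite (bigD1 (Ordinal i_lt)) //=.
rewrite eqxx mul1r big1 ?addr0 // => j /negPf->; exact: mul0r.
Qed.

Definition model_residue : S -> R :=
  model_eval (residue alpha \o @mpolyC 4 k) (residue alpha V) (residue alpha X)
    (residue alpha Y) (residue alpha Z).

(** The defining relations, solved for the quadratic monomials other than [vz],
    [xz], [yz]. *)
Lemma residue_relations :
  let r := residue alpha in let c := r (alpha%:MP) in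
  [/\ r V * r V = 0, r Z * r Z = 0 & r X * r Y = 0] /\
  [/\ r V * r X = - (c * (r X * r Z)), r V * r Y = - (r Y * r Z),
      r Y * r Y = c * (r X * r Z) & r X * r X = - (r Y * r Z)].
Proof.
move=> r c; have rel p : p \in relators alpha -> r p = 0.
  exact: residue_relator.
have e1 : r V * r V = 0.
  by rewrite -rmorphM -expr2; apply: rel; rewrite !inE eqxx ?orbT.
have e2 : r Z * r Z = 0.
  by rewrite -rmorphM -expr2; apply: rel; rewrite !inE eqxx ?orbT.
have e3 : r X * r Y = 0.
  by rewrite -rmorphM; apply: rel; rewrite !inE eqxx ?orbT.
have e4 : r V * r X + c * (r X * r Z) = 0.
  rewrite -!rmorphM -rmorphD mul_mpolyC.
  by apply: rel; rewrite !inE eqxx ?orbT.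
have e5 : r V * r Y + r Y * r Z = 0.
  by rewrite -!rmorphM -rmorphD; apply: rel; rewrite !inE eqxx ?orbT.
have e6 : r V * r X + r Y * r Y = 0.
  by rewrite -!rmorphM -rmorphD -expr2; apply: rel; rewrite !inE eqxx ?orbT.
have e7 : r V * r Y - r X * r X = 0.
  by rewrite -!rmorphM -rmorphB -expr2; apply: rel; rewrite !inE eqxx ?orbT.
have vx : r V * r X = - (c * (r X * r Z)).
  by apply/eqP; rewrite -addr_eq0 e4.
have vy : r V * r Y = - (r Y * r Z) by apply/eqP; rewrite -addr_eq0 e5.
split; split=> //.
  by apply/eqP; move/eqP: e6; rewrite addrC addr_eq0 vx opprK.
by apply/eqP; move/eqP: e7; rewrite subr_eq0 vy eq_sym.
Qed.

Fact model_residue_zmod : zmod_morphism model_residue.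
Proof. exact: model_eval_zmod. Qed.
Fact model_residue_monoid : monoid_morphism model_residue.
Proof.
have [[vv zz xy] [vx vy yy xx]] := residue_relations.
exact: model_eval_monoid.
Qed.
HB.instance Definition _ :=
  GRing.isZmodMorphism.Build S R model_residue model_residue_zmod.
HB.instance Definition _ :=
  GRing.isMonoidMorphism.Build S R model_residue model_residue_monoid.

Definition model_gen (i : 'I_4) : S :=
  nth 0 [:: model_v alpha; model_x alpha; model_y alpha; model_z alpha] i.
Definition poly_model : {mpoly k[4]} -> S :=
  mmap (@model_const k alpha) model_gen.
HB.instance Definition _ := GRing.RMorphism.on poly_model.

Lemma poly_modelX i : poly_model 'X_i = model_gen i.
Proof. by rewrite /poly_model mmapX mmap1U. Qed.

Lemma poly_model_relator p : p \in relators alpha -> poly_model p = 0.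
Proof.
have E : all (fun p => poly_model p == 0) (relators alpha).
  rewrite /= -!mul_mpolyC !expr2 !(rmorphD, rmorphN, rmorphM) /=.
  rewrite !poly_modelX /poly_model mmapC /model_gen /=.
  by do 7![apply/andP; split; first by apply/eqP; apply: modelP => /=; ring].
by move/allP: E => E /E/eqP.
Qed.

Lemma poly_model_ideal p : p \in ideal_I alpha -> poly_model p = 0.
Proof.
move=> /asboolP[c ->]; rewrite rmorph_sum big1 // => i _.
by rewrite rmorphM [X in _ * X]poly_model_relator ?mulr0 // mem_nth.
Qed.

Lemma model_residue_gen i : model_residue (model_gen i) = residue alpha 'X_i.
Proof.
case: i => [[|[|[|[|//]]]] i_lt];
  rewrite /model_residue /model_eval /model_gen /= !rmorph0 !rmorph1;
  rewrite !(mul0r, mul1r, add0r, addr0) /=;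
  by congr (residue _ 'X_(_)); apply: val_inj.
Qed.

Lemma model_residueC c :
  model_residue (model_const alpha c) = residue alpha c%:MP.
Proof.
by rewrite /model_residue /model_eval /= !rmorph0 !(mul0r, addr0).
Qed.

(** Both sides are ring morphisms, so constants and variables suffice; this is
    where the eight basis elements are seen to span. *)
Lemma model_residueK p : model_residue (poly_model p) = residue alpha p.
Proof.
apply: (mpoly_rmorphism_ext (f := model_residue \o poly_model)) => [c|i] /=.
  by rewrite /poly_model mmapC model_residueC.
by rewrite poly_modelX model_residue_gen.
Qed.

(** The basis elements are independent: [poly_model] kills the ideal and
    recovers the coordinates from the obvious polynomial representative. *)
Lemma model_residue_inj : injective model_residue.
Proof.
pose P (s : S) : {mpoly k[4]} := model_eval (@mpolyC 4 k) V X Y Z s.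
have PE s : model_residue s = residue alpha (P s).
  by rewrite /model_residue /P /model_eval /= !(rmorphD, rmorphM).
have PK s : poly_model (P s) = s.
  rewrite /P /model_eval !(rmorphD, rmorphM) /= !poly_modelX.
  rewrite /poly_model !mmapC /model_gen.
  by apply: modelP => /=; ring.
move=> s t; rewrite !PE => /residueP/poly_model_ideal/eqP.
by rewrite rmorphB /= !PK subr_eq0 => /eqP.
Qed.

Lemma model_residue_surj r : exists s, model_residue s = r.
Proof.
by exists (poly_model (repr r)); rewrite model_residueK /residue reprK.
Qed.

End ModelIso.

(** * Exactness of the matrices over the model *)

Definition mx2 (A : comNzRingType) (a b c d : A) : 'M[A]_2 :=
  \matrix_(i, j) if i == 0 then if j == 0 then a else b
                 else if j == 0 then c else d.
Definition col2 (A : comNzRingType) (a b : A) : 'cV[A]_2 :=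
  \col_i if i == 0 then a else b.

Section TwoByTwo.
Variable A : comNzRingType.
Implicit Types (a b c d : A).

Lemma col2E (u : 'cV[A]_2) : u = col2 (u 0 0) (u 1 0).
Proof.
apply/colP => -[[|[|//]] i_lt]; rewrite !mxE /=; congr (u _ _); exact: val_inj.
Qed.

Lemma col2_inj a b c d : col2 a b = col2 c d -> a = c /\ b = d.
Proof. by move=> /colP e; have := e 0; have := e 1; rewrite !mxE. Qed.

Lemma col20 : 0 = col2 0 0 :> 'cV[A]_2.
Proof. by apply/colP => i; rewrite !mxE; case: ifP. Qed.

Lemma col2D a b c d : col2 a b + col2 c d = col2 (a + c) (b + d).
Proof. by apply/colP => i; rewrite !mxE; case: ifP. Qed.

Lemma mul_mx2_col2 a b c d x y :
  mx2 a b c d *m col2 x y = col2 (a * x + b * y) (c * x + d * y).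
Proof.
apply/colP => i; rewrite !mxE !big_ord_recl big_ord0 !mxE /= addr0.
by case: ifP.
Qed.

Lemma trmx_mx2 a b c d : (mx2 a b c d)^T = mx2 a c b d.
Proof.
by apply/matrixP => i j; rewrite !mxE; case: (i == 0); case: (j == 0).
Qed.

Lemma mul_mx2 a b c d a' b' c' d' :
  mx2 a b c d *m mx2 a' b' c' d' =
  mx2 (a * a' + b * c') (a * b' + b * d') (c * a' + d * c') (c * b' + d * d').
Proof.
apply/matrixP => i j; rewrite !mxE !big_ord_recl big_ord0 !mxE /= addr0.
by case: (i == 0); case: (j == 0).
Qed.

End TwoByTwo.

Section ModelMatrices.
Variables (k : fieldType) (alpha : k).
Hypothesis alpha0 : alpha != 0.
Local Notation S := (model alpha).
Local Notation Mk := (@Model k alpha).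
Local Notation v := (model_v alpha).
Local Notation x := (model_x alpha).
Local Notation y := (model_y alpha).
Local Notation z := (model_z alpha).

(** The matrix [d_(-s)] is [dmx (alpha ^+ s)]; allowing any scalar [q] makes
    room for [1 / alpha] and its square, which occur beyond [M_0]. *)
Definition dmx (q : k) : 'M[S]_2 := mx2 v (model_const alpha q * x) y z.

Lemma dmx_mul0 q : dmx (alpha * q) *m dmx q = 0.
Proof.
rewrite mul_mx2; apply/matrixP => i j; rewrite !mxE.
by case: ifP => _; case: ifP => _; apply: modelP => /=; ring.
Qed.

(** Comparing coordinates: there is no constant term, and the linear terms form
    a space spanned by the columns of [dmx (q / alpha)], unless [alpha q = 1].
    The scalar [t] is the coefficient of the extra socle generator [(0, xz)],
    which adds one term to the last two equations. *)
Lemma dmx_ker_eqs q t u1 u2 : q != 0 ->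
    v * u1 + model_const alpha q * x * u2 = 0 ->
    y * u1 + z * u2 + Mk 0 0 0 0 0 0 t 0 = 0 ->
  [/\ c1 u1 = 0, c1 u2 = 0, cz u1 = 0 & cv u2 = 0] /\
  [/\ cy u2 = cv u1, cz u2 = alpha / q * cx u1, cx u2 = - (alpha * cy u1 + t)
    & (alpha * q - 1) * cy u1 + q * t = 0].
Proof.
move=> q0; case: u1 => t1 v1 x1 y1 z1 a1 b1 d1.
case: u2 => t2 v2 x2 y2 z2 a2 b2 d2 e f.
have t10 : t1 = 0 by move: (congr1 (@cy _ _) f) => /= <-; ring.
have t20 : t2 = 0 by move: (congr1 (@cz _ _) f) => /= <-; ring.
subst t1 t2.
have z10 : z1 = 0 by move: (congr1 (@cvz _ _) e) => /= <-; ring.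
have v20 : v2 = 0 by move: (congr1 (@cvz _ _) f) => /= <-; ring.
subst z1 v2.
have eb : q * z2 - alpha * x1 = 0.
  by move: (congr1 (@cxz _ _) e) => /= <-; ring.
have ec : y1 + q * x2 = 0.
  by apply: oppr_inj; rewrite oppr0; move: (congr1 (@cyz _ _) e) => /= <-; ring.
have fb : alpha * y1 + t + x2 = 0.
  by move: (congr1 (@cxz _ _) f) => /= <-; ring.
have fc : y2 - v1 = 0 by move: (congr1 (@cyz _ _) f) => /= <-; ring.
split; split=> //=.
- by apply/eqP; rewrite -subr_eq0 fc.
- have -> : z2 = alpha / q * x1 + (q * z2 - alpha * x1) / q by field.
  by rewrite eb mul0r addr0.
- by apply/eqP; rewrite -addr_eq0 addrC fb.
- have -> : (alpha * q - 1) * y1 + q * t =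
              q * (alpha * y1 + t + x2) - (y1 + q * x2) by ring.
  by rewrite fb ec mulr0 subr0.
Qed.

(** The linear part of a kernel element is a combination of the columns of [dmx
    q] by [alpha^2 q != 1]; the quadratic part is then matched by linear
    coefficients, which can be solved for because [alpha q != 1]. *)
Lemma dmx_exact q : q != 0 -> alpha * q != 1 -> alpha * (alpha * q) != 1 ->
  mx_exact (dmx (alpha * q)) (dmx q).
Proof.
move=> q0 aq aaq u; split=> [|[w ->]]; last by rewrite mulmxA dmx_mul0 mul0mx.
rewrite (col2E u) mul_mx2_col2 col20 => /col2_inj[e f].
have [[]] := dmx_ker_eqs (t := 0) (mulf_neq0 alpha0 q0) e (etrans (addr0 _) f).
case: (u 0 0) {e f} => t1 v1 x1 y1 z1 a1 b1 d1 /=.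
case: (u 1 0) => t2 v2 x2 y2 z2 a2 b2 d2 /= -> -> -> -> [-> -> ->].
rewrite mulr0 !addr0.
move=> /eqP; rewrite mulf_eq0 subr_eq0 (negPf aaq) => /eqP->.
have aq1 : alpha * q - 1 != 0 by rewrite subr_eq0.
(* The constants reproduce the linear part, the linear terms the quadratic one;
   [y'] solves the two equations in the coefficients of [xz] and [yz] that are
   coupled. *)
pose y' := (d1 + q * b2) / (alpha * q - 1).
exists (col2 (Mk v1 0 (- (b1 + alpha * q * a2) / alpha) y' a1 0 0 0)
             (Mk (x1 / q) a2 (b2 - alpha * y') (d2 - a1) 0 0 0 0)).
by rewrite mul_mx2_col2; congr col2; apply: modelP; rewrite /y' /=;
   field; rewrite ?q0 ?aq1 ?alpha0.
Qed.

(** Here [q != 1] controls the linear part of the kernel and [alpha q != 1] the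
    quadratic part. *)
Lemma dmx_trmx_exact q : q != 1 -> alpha * q != 1 ->
  mx_exact (dmx q)^T (dmx (alpha * q))^T.
Proof.
move=> q1 aq1 u; split=> [|[w ->]]; last first.
  by rewrite mulmxA -trmx_mul dmx_mul0 trmx0 mul0mx.
rewrite !trmx_mx2 (col2E u) mul_mx2_col2 col20 => /col2_inj[].
case: (u 0 0) => t1 v1 x1 y1 z1 a1 b1 d1.
case: (u 1 0) => t2 v2 x2 y2 z2 a2 b2 d2 e f.
have t10 : t1 = 0 by move: (congr1 (@cv _ _) e) => /= <-; ring.
have t20 : t2 = 0 by move: (congr1 (@cy _ _) e) => /= <-; ring.
subst t1 t2.
have z10 : z1 = 0 by move: (congr1 (@cvz _ _) e) => /= <-; ring.
have v20 : v2 = 0 by move: (congr1 (@cvz _ _) f) => /= <-; ring.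
subst z1 v2.
have eb : alpha * (y2 - x1) = 0.
  by move: (congr1 (@cxz _ _) e) => /= <-; ring.
have ec : z2 - y1 = 0 by move: (congr1 (@cyz _ _) e) => /= <-; ring.
have fb : x2 - alpha * q * v1 = 0.
  by move: (congr1 (@cxz _ _) f) => /= <-; ring.
have fc : y2 - q * x1 = 0 by move: (congr1 (@cyz _ _) f) => /= <-; ring.
have q1' : 1 - q != 0 by rewrite subr_eq0 eq_sym.
have aq1' : 1 - alpha * q != 0 by rewrite subr_eq0 eq_sym.
have y2x1 : y2 = x1.
  by move/eqP: eb; rewrite mulf_eq0 (negPf alpha0) subr_eq0 => /eqP.
have x10 : x1 = 0.
  apply/eqP; have : (1 - q) * x1 = 0 by rewrite -fc y2x1; ring.
  by move/eqP; rewrite mulf_eq0 (negPf q1').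
have z2E : z2 = y1 by apply/eqP; rewrite -subr_eq0 ec.
have x2E : x2 = alpha * q * v1 by apply/eqP; rewrite -subr_eq0 fb.
subst y2 z2 x2 x1 => {e f eb ec fb fc}.
pose x' := (d2 - b1 / alpha) / (1 - alpha * q).
exists (col2 (Mk v1 0 x' 0 a1 0 0 0)
             (Mk y1 a2 (b2 - alpha * q * a1) (x' + b1 / alpha) (d1 + a2)
                0 0 0)).
by rewrite mul_mx2_col2; congr col2; apply: modelP; rewrite /x' /=;
   field; rewrite ?aq1' ?alpha0.
Qed.

Definition socle_xz : S := Mk 0 0 0 0 0 0 1 0.
Definition socle_vz : S := Mk 0 0 0 0 0 1 0 0.

Lemma mul_socle_xz s : s * socle_xz = Mk 0 0 0 0 0 0 (c1 s) 0.
Proof. by apply: modelP => /=; ring. Qed.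
Lemma mul_socle_vz s : s * socle_vz = Mk 0 0 0 0 0 (c1 s) 0 0.
Proof. by apply: modelP => /=; ring. Qed.

(** Generators of the kernel of [dmx 1]: the columns of [dmx (1 / alpha)] miss
    one dimension of the socle, supplied by [(0, xz)]. *)
Definition ker_d1_gens : 'M[S]_(2, 2 + 1) :=
  row_mx (dmx alpha^-1) (col2 0 socle_xz).

(** Its cokernel is the residue field. *)
Definition row_vars : 'M[S]_(1, 4) := \row_i nth 0 [:: v; x; y; z] i.

(** Generators of the kernel of [dmx (1 / alpha)], which in degree 1 is larger
    by one than the span of the columns of [dmx (1 / alpha^2)]. *)
Definition ker_dV_gens : 'M[S]_(2, 2 + 1) :=
  row_mx (dmx (alpha^-1 / alpha)) (col2 y (- model_const alpha alpha * x)).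

Lemma mul_col_const (a b : S) (w : 'cV[S]_1) :
  col2 a b *m w = col2 (a * w 0 0) (b * w 0 0).
Proof.
by apply/colP => i; rewrite !mxE big_ord1 !mxE; case: ifP.
Qed.

Lemma row_mulE n m p (A : 'M[S]_(n, m)) (B : 'M[S]_(n, p))
    (u : 'cV_(m + p)) :
  row_mx A B *m u = A *m usubmx u + B *m dsubmx u.
Proof. by rewrite -[u in LHS]vsubmxK mul_row_col. Qed.

Lemma in_im_row_vars (u : 'cV[S]_1) : in_im row_vars u <-> c1 (u 0 0) = 0.
Proof.
split=> [[w ->]|u0].
  rewrite !mxE !big_ord_recl big_ord0 !mxE /=; ring.
exists (\col_i nth 0 [:: Mk (cv (u 0 0)) 0 0 0 (cvz (u 0 0)) 0 0 0;
  Mk (cx (u 0 0)) 0 0 0 (cxz (u 0 0)) 0 0 0;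
  Mk (cy (u 0 0)) 0 0 0 (cyz (u 0 0)) 0 0 0; Mk (cz (u 0 0)) 0 0 0 0 0 0 0] i).
apply/matrixP => i j; rewrite !ord1 !mxE !big_ord_recl big_ord0 !mxE /=.
by apply: modelP; rewrite /= ?u0; ring.
Qed.

Lemma dmx1_exact : alpha != 1 -> mx_exact (dmx 1) ker_d1_gens.
Proof.
move=> a1 u; split=> [|[w ->]]; last first.
  have -> : dmx 1 = dmx (alpha * alpha^-1) by rewrite divff.
  rewrite mulmxA mul_mx_row dmx_mul0 -/(dmx _) mul_mx2_col2 !mulr0 !add0r.
  rewrite !mul_socle_xz /=.
  rewrite row_mulE mul0mx add0r mul_col_const col20; congr col2.
    by apply: modelP => /=; ring.
  by apply: modelP => /=; ring.
rewrite (col2E u) mul_mx2_col2 col20 => /col2_inj[e f].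
have [[]] := dmx_ker_eqs (t := 0) (oner_neq0 k) e (etrans (addr0 _) f).
case: (u 0 0) {e f} => t1 v1 x1 y1 z1 p1 b1 d1 /=.
case: (u 1 0) => t2 v2 x2 y2 z2 p2 b2 d2 /= -> -> -> -> [-> -> ->].
rewrite mulr0 !addr0.
move=> /eqP; rewrite mulf_eq0 mulr1 subr_eq0 (negPf a1) => /eqP->.
exists (col_mx
  (col2 (Mk v1 0 (- (b1 + p2) / alpha) (- d1) p1 0 0 0)
        (Mk (alpha * x1) p2 0 (d2 - p1) 0 0 0 0))
  (const_mx (model_const alpha (b2 + alpha * d1)))).
rewrite mul_row_col mul_mx2_col2 mul_col_const mxE col2D.
by congr col2; apply: modelP; rewrite /= ?mulr0 ?divr1; field.
Qed.

Lemma dmxV_exact : alpha^-1 != 1 -> mx_exact (dmx alpha^-1) ker_dV_gens.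
Proof.
move=> a1 u; have ai0 : alpha^-1 != 0 by rewrite invr_eq0.
split=> [|[w ->]]; last first.
  have dV0 : dmx alpha^-1 *m dmx (alpha^-1 / alpha) = 0.
    by rewrite -{1}(mulVKf alpha0 alpha^-1) mulrC [in dmx _]mulrC dmx_mul0.
  rewrite /ker_dV_gens row_mulE mulmxDr mulmxA dV0 mul0mx add0r mul_col_const.
  by rewrite mul_mx2_col2 col20; congr col2; apply: modelP => /=; field.
rewrite (col2E u) mul_mx2_col2 col20 => /col2_inj[e f].
have [[]] := dmx_ker_eqs (t := 0) ai0 e (etrans (addr0 _) f).
case: (u 0 0) {e f} => t1 v1 x1 y1 z1 p1 b1 d1 /=.
case: (u 1 0) => t2 v2 x2 y2 z2 p2 b2 d2 /= -> -> -> -> [-> -> -> _].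
rewrite addr0.
have a1' : alpha^-1 - 1 != 0 by rewrite subr_eq0.
pose y' := (d1 + alpha^-1 / alpha * b2) / (alpha^-1 - 1).
exists (col_mx
  (col2 (Mk v1 0 (- (b1 + alpha^-1 * p2) / alpha) y' p1 0 0 0)
        (Mk (alpha ^+ 2 * x1) p2 (b2 - alpha * y') (d2 - p1) 0 0 0 0))
  (const_mx (model_const alpha y1))).
rewrite mul_row_col mul_mx2_col2 mul_col_const mxE col2D.
have a1'' : 1 + -1 * alpha != 0.
  by rewrite mulN1r subr_eq0 eq_sym -invr_eq1.
by congr col2; apply: modelP; rewrite /y' /=;
   field; rewrite ?alpha0 ?a1'' ?oner_neq0.
Qed.

(** In a relation between these generators the coefficient of [(0, xz)] has no
    constant term, hence annihilates it. So the relations split as a block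
    matrix, and the residue field is a summand of the cokernel. *)
Lemma ker_d1_gens_exact : alpha^-1 != 1 ->
  mx_exact ker_d1_gens (block_mx ker_dV_gens 0 0 row_vars).
Proof.
move=> a1 u; have ai0 : alpha^-1 != 0 by rewrite invr_eq0.
have socleE (t : 'cV[S]_1) : c1 (t 0 0) = 0 -> col2 0 socle_xz *m t = 0.
  move=> t0; rewrite mul_col_const mul0r [socle_xz * _]mulrC mul_socle_xz t0.
  by rewrite -col20.
rewrite -[u]vsubmxK [_ *m _]mul_row_col; split; last first.
  move=> /in_im_block[/dmxV_exact->// /in_im_row_vars/socleE->]; exact: addr0.
move=> e; apply/in_im_block; suff t0 : c1 (dsubmx u 0 0) = 0.
  split; last exact/in_im_row_vars.
  by apply/dmxV_exact => //; rewrite -[RHS]e socleE // addr0.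
move: e; rewrite (col2E (usubmx u)) mul_mx2_col2 mul_col_const col2D.
rewrite mul0r addr0 [socle_xz * _]mulrC mul_socle_xz col20 => /col2_inj[e f].
have [_ []] := dmx_ker_eqs ai0 e f.
rewrite divff // subrr mul0r add0r => _ _ _ /eqP.
by rewrite mulf_eq0 (negPf ai0) => /eqP.
Qed.

(** The row [(xz, 0)] vanishes on the kernel of [dmx 1], which has no constant
    terms, but it is not a combination of the rows of [dmx 1]. *)
Lemma dmx1_not_coexact : ~ coexact (dmx 1).
Proof.
move=> co; have [u|t /matrixP tE] := co (\row_i if i == 0 then socle_xz else 0).
  rewrite (col2E u) mul_mx2_col2 col20 => /col2_inj[e f].
  have [[u0 _ _ _] _] :=
    dmx_ker_eqs (t := 0) (oner_neq0 k) e (etrans (addr0 _) f).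
  apply/matrixP => i j; rewrite !mxE !big_ord_recl big_ord0 !mxE /=.
  by rewrite mulrC mul_socle_xz u0 mul0r !addr0.
have := tE 0 0; have := tE 0 1; rewrite !mxE !big_ord_recl !big_ord0 !mxE /=.
move: (t 0 ord0) (t 0 (fintype.lift ord0 ord0)).
move=> [t1 v1 x1 y1 z1 p1 b1 d1] [t2 v2 x2 y2 z2 p2 b2 d2] f e.
have t10 : t1 = 0.
  by have /= := congr1 (@cv _ _) e; rewrite !(mulr1, mulr0, add0r, addr0) => <-.
have t20 : t2 = 0.
  by have /= := congr1 (@cy _ _) e; rewrite !(mulr1, mulr0, add0r, addr0) => <-.
subst t1 t2.
have fc : y2 - x1 = 0 by move: (congr1 (@cyz _ _) f) => /= ->; ring.
have := congr1 (@cxz _ _) e => /= eb.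
have : 1 = alpha * (y2 - x1) by rewrite eb; ring.
by rewrite fc mulr0 => /eqP; rewrite oner_eq0.
Qed.

(** The form sending the extra socle generator to [vz] and the other generators
    to 0 does not extend: an extension would send [(0, xz)] to a multiple of
    [xz]. *)
Lemma ker_d1_gens_not_coexact : alpha^-1 != 1 -> ~ coexact ker_d1_gens.
Proof.
move=> a1 co; have [u|t tE] := co (row_mx 0 (const_mx socle_vz)).
  rewrite -[u]vsubmxK => /(ker_d1_gens_exact a1).
  move=> /in_im_block[_ /in_im_row_vars u0].
  rewrite mul_row_col mul0mx add0r; move: (dsubmx u) u0 => w w0.
  apply/matrixP => i j.
  by rewrite !mxE big_ord1 !mxE !ord1 mulrC mul_socle_vz w0.
move: tE; rewrite mul_mx_row => /eq_row_mx[_ /matrixP/(_ 0 0)].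
rewrite !mxE !big_ord_recl big_ord0 !mxE /= mulr0 add0r addr0 mul_socle_xz.
by move=> /(congr1 (@cvz _ _))/eqP /=; rewrite oner_eq0.
Qed.

(** The row [(x, y)] is the element of degree 1 that the transpose of [dmx 1]
    kills in excess of the columns of the transpose of [dmx alpha]. *)
Lemma dmx_alpha_not_coexact : alpha != 1 -> alpha * alpha != 1 ->
  ~ coexact (dmx alpha).
Proof.
move=> a1 aa co.
have := dmx_exact (oner_neq0 k); rewrite mulr1 => /(_ a1 aa) ex.
have [u|t /matrixP/(_ 0 0)] :=
  co (\row_i if i == 0 then x else y).
  move=> /ex[w ->]; rewrite (col2E w) mul_mx2_col2.
  apply/matrixP => i j; rewrite !mxE !big_ord_recl big_ord0 !mxE /=.
  by apply: modelP => /=; ring.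
rewrite !mxE !big_ord_recl big_ord0 !mxE /= => /(congr1 (@cx _ _))/eqP /=.
by rewrite !(mulr0, add0r, addr0) oner_eq0.
Qed.

(** Consider the form on the maximal ideal that sends [v] to [vz] and the other
    variables to 0. If it were multiplication by [t], then [tz = 0] and [tv =
    vz] would give [t] the coefficients 0 at [v] and 1 at [z], whence [tx = xz
    + c x^2] for a scalar [c], which is not 0. *)
Lemma row_vars_not_coexact : ~ coexact row_vars.
Proof.
move=> co; have [u u0|t /matrixP tE] :=
  co (\row_i if i == 0 then socle_vz else 0).
  have {}u0 : c1 (u 0 0) = 0.
    move/matrixP/(_ 0 0)/(congr1 (@cv _ _)): u0.
    rewrite !mxE !big_ord_recl big_ord0 !mxE /= => <-.
    have -> : ord0 = 0 :> 'I_4 by []. 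
    by rewrite !(mul0r, mul1r, addr0, add0r).
  apply/matrixP => i j; rewrite !mxE !big_ord_recl big_ord0 !mxE /= !ord1.
  by rewrite mulrC mul_socle_vz u0 !mul0r !addr0.
have := tE 0 0; have := tE 0 (inord 1); have := tE 0 (inord 3).
rewrite !mxE !big_ord1 !mxE -!val_eqE /= !inordK //=.
case: (t 0 0) => t1 v1 x1 y1 z1 p1 b1 d1 f g e.
have z1E : 1 = z1 by have /= := congr1 (@cvz _ _) e => ->; ring.
have v10 : 0 = v1 by have /= := congr1 (@cvz _ _) f => ->; ring.
have /= := congr1 (@cxz _ _) g; rewrite -z1E -v10.
rewrite !(mulr0, mulr1, mul0r, addr0, add0r, subr0) => /eqP.
by rewrite eq_sym oner_eq0.
Qed.

(** Its cokernel is [R/(v)]. *)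
Definition mx_v : 'M[S]_1 := const_mx v.

Lemma in_im_v (u : 'cV[S]_1) : in_im mx_v u <->
  [/\ c1 (u 0 0) = 0, cx (u 0 0) = 0, cy (u 0 0) = 0 & cz (u 0 0) = 0].
Proof.
split=> [[w ->]|[u1 ux uy uz]].
  by rewrite !mxE big_ord1 !mxE; split; rewrite /=; ring.
exists (const_mx (Mk (cv (u 0 0)) 0 (- cxz (u 0 0) / alpha) (- cyz (u 0 0))
  (cvz (u 0 0)) 0 0 0)).
apply/matrixP => i j; rewrite !ord1 !mxE big_ord1 !mxE.
by apply: modelP; rewrite /= ?u1 ?ux ?uy ?uz; field.
Qed.

(** The annihilator of [v] is the ideal of [v]: multiplication by [v] is
    injective on the span of [x, y, z]. *)
Lemma v_exact : mx_exact mx_v mx_v.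
Proof.
move=> u; rewrite -/(in_im mx_v u) in_im_v.
have E : mx_v *m u = const_mx (v * u 0 0).
  by apply/matrixP => i j; rewrite !ord1 !mxE big_ord1 !mxE.
rewrite E; split=> [/matrixP/(_ 0 0)|[u1 ux uy uz]]; last first.
  by apply/matrixP => i j; rewrite !mxE; apply: modelP;
     rewrite /= ?u1 ?ux ?uy ?uz; ring.
rewrite !mxE; case: (u 0 0) => t1 v1 x1 y1 z1 p1 b1 d1 /= e.
have t10 : t1 = 0 by have /= := congr1 (@cv _ _) e => <-; ring.
have z10 : z1 = 0 by have /= := congr1 (@cvz _ _) e => <-; ring.
have y10 : y1 = 0.
  by apply: oppr_inj; rewrite oppr0; have /= := congr1 (@cyz _ _) e => <-; ring.
have : alpha * x1 = 0.
  by apply: oppr_inj; rewrite oppr0; have /= := congr1 (@cxz _ _) e => <-; ring.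
by move=> /eqP; rewrite mulf_eq0 (negPf alpha0) => /eqP.
Qed.

Definition three_row_vars : 'M[S]_(1 + (1 + 1), 4 + (4 + 4)) :=
  block_mx row_vars 0 0 (block_mx row_vars 0 0 row_vars).

(** Induces the embedding of [k^3] into [R/(v)] with image the maximal ideal
    modulo [v]. *)
Definition row_xyz : 'M[S]_(1, 1 + (1 + 1)) :=
  row_mx (const_mx x) (row_mx (const_mx y) (const_mx z)).

Lemma row_xyzE (a b c : 'cV[S]_1) :
  (row_xyz *m col_mx a (col_mx b c)) 0 0 = x * a 0 0 + (y * b 0 0 + z * c 0 0).
Proof. by rewrite !mul_row_col !mxE !big_ord1 !mxE. Qed.

Lemma row_xyz_inj u : in_im three_row_vars u <-> in_im mx_v (row_xyz *m u).
Proof.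
rewrite -[u]vsubmxK -[dsubmx u]vsubmxK !in_im_block in_im_v row_xyzE.
rewrite !in_im_row_vars; move: (usubmx u 0 0) => a.
move: (usubmx (dsubmx u) 0 0) (dsubmx (dsubmx u) 0 0) => b c.
split=> [[a0 [b0 c0]]|[/= _ a0 b0 c0]].
  by split; rewrite /= ?a0 ?b0 ?c0; ring.
by split; [rewrite -a0 | split; [rewrite -b0 | rewrite -c0]]; ring.
Qed.

Lemma row_xyz_exact u :
  in_im row_vars u <-> exists t, in_im mx_v (u - row_xyz *m t).
Proof.
rewrite in_im_row_vars; split=> [u0|[t /in_im_v[]]]; last first.
  rewrite -[t]vsubmxK -[dsubmx t]vsubmxK 2!mxE row_xyzE => + _ _ _.
  by rewrite /= => <-; ring.
pose C t : 'cV[S]_1 := const_mx (model_const alpha t).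
exists (col_mx (C (cx (u 0 0))) (col_mx (C (cy (u 0 0))) (C (cz (u 0 0))))).
by rewrite in_im_v 2!mxE row_xyzE !mxE; split; rewrite /= ?u0; ring.
Qed.

End ModelMatrices.

(** * Ext over the ring *)

Section ExtM.
Variables (k : fieldType) (alpha : k).
Hypothesis alphaP : infinite_order alpha.
Local Notation R := (ringR alpha).
Local Notation f := (@model_residue k alpha).
Local Notation f_inj := (@model_residue_inj k alpha).
Local Notation f_surj := (@model_residue_surj k alpha).

Let alpha0 : alpha != 0 := alphaP.1.

Lemma expr_neq1 n : alpha ^+ n.+1 != 1.
Proof. exact: (alphaP.2 n.+1 isT). Qed.

Lemma alpha_neq1 : alpha != 1.
Proof. by have := expr_neq1 0; rewrite expr1. Qed.

Lemma alphaV_neq1 : alpha^-1 != 1.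
Proof. by rewrite invr_eq1 alpha_neq1. Qed.

(** The complex with all differentials [v] is exact and equal to its dual. *)
Lemma Ext_coker_v j : Ext_eq0 (coker (map_mx f (mx_v alpha))) R^o j.+1.
Proof.
elim: j => [|j IHj]; last first.
  exact/(Ext_coker_shift _ (mx_exact_map f_inj f_surj (v_exact alpha0))).
apply/Ext1_coker/(coexact_map f_inj f_surj).
apply: (coexact_trmx (B := mx_v alpha)); last first.
  by rewrite trmx_const; apply: v_exact.
apply/matrixP => a b; rewrite !mxE big_ord1 !mxE.
by apply: modelP => /=; ring.
Qed.

(** Descent along [0 -> k^3 -> R/(v) -> k -> 0] to degree 1, followed by
    projection of [k^3] to one factor. *)
Lemma Ext_residue_field_neq0 j :
  ~ Ext_eq0 (coker (map_mx f (row_vars alpha))) R^o j.+1.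
Proof.
elim: j => [/Ext1_coker/(coexact_map f_inj f_surj)|j IHj Ek].
  exact: row_vars_not_coexact.
apply: IHj; have := Ext_coker_first_term (A := map_mx f (three_row_vars alpha))
  (U := map_mx f (row_xyz alpha)) _ _ (@Ext_coker_v j) Ek.
rewrite /three_row_vars !map_block_mx !raddf0 => E.
apply/Ext_coker_block/Ext_coker_block/E => u.
  have [w ->] := map_mx_surj f_surj u.
  rewrite -[block_mx _ _ _ _](_ : map_mx f (three_row_vars alpha) = _);
    last by rewrite !map_block_mx !raddf0.
  by rewrite -map_mxM !(in_im_map f_inj f_surj); apply: row_xyz_inj.
have [w ->] := map_mx_surj f_surj u.
rewrite (in_im_map f_inj f_surj) (row_xyz_exact alpha0); split=> [][t tE].
  exists (map_mx f t); rewrite -map_mxM -raddfB.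
  exact/(in_im_map f_inj f_surj).
have [t' t'E] := map_mx_surj f_surj t; exists t'.
by apply/(in_im_map f_inj f_surj); rewrite raddfB /= map_mxM -t'E.
Qed.

(** Degree 1 and 2 are explicit; from degree 3 on, the residue field is a
    summand of the second syzygy of the cokernel. *)
Lemma Ext_coker_dmx1_neq0 j :
  ~ Ext_eq0 (coker (map_mx f (dmx alpha 1))) R^o j.+1.
Proof.
have ex1 := mx_exact_map f_inj f_surj (dmx1_exact alpha0 alpha_neq1).
have ex2 := mx_exact_map f_inj f_surj (ker_d1_gens_exact alpha0 alphaV_neq1).
case: j => [|[|j]].
- by move=> /Ext1_coker/(coexact_map f_inj f_surj); apply: dmx1_not_coexact.
- move=> /(Ext_coker_shift _ ex1)/Ext1_coker/(coexact_map f_inj f_surj).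
  exact: ker_d1_gens_not_coexact alphaV_neq1.
move=> /(Ext_coker_shift _ ex1)/(Ext_coker_shift _ ex2).
rewrite map_block_mx !raddf0 => /Ext_coker_block; exact: Ext_residue_field_neq0.
Qed.

(** Dimension shift replaces [s] by [s - 1] and lowers the degree by one, until
    either degree 1 or [s = 0] is reached. *)
Lemma Ext_coker_dmx s j :
  Ext_eq0 (coker (map_mx f (dmx alpha (alpha ^+ s)))) R^o j.+1 <-> (j.+1 < s)%N.
Proof.
elim: s j => [|s IHs] j.
  by rewrite expr0; split=> // /Ext_coker_dmx1_neq0.
case: j => [|j].
  rewrite Ext1_coker (coexact_map f_inj f_surj); case: s {IHs} => [|s].
    rewrite expr1; split=> // /dmx_alpha_not_coexact[]//.
      exact: alpha_neq1.
    exact: (expr_neq1 1).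
  split=> // _; rewrite exprS; apply: coexact_trmx; first exact: dmx_mul0.
  by apply: dmx_trmx_exact => //; rewrite -?exprS expr_neq1.
rewrite ltnS -IHs exprS; apply/Ext_coker_shift/(mx_exact_map f_inj f_surj).
by apply: dmx_exact; rewrite ?expf_neq0 -?exprS ?expr_neq1.
Qed.

(** On transposes dimension shift raises [s], so the exceptional values of the
    exponent are never met. *)
Lemma Ext_coker_dmx_trmx s j :
  Ext_eq0 (coker (map_mx f (dmx alpha (alpha ^+ s.+1)))^T) R^o j.+1.
Proof.
rewrite map_trmx; elim: j s => [|j IHj] s.
  apply/Ext1_coker/(coexact_map f_inj f_surj).
  apply: (coexact_trmx (B := (dmx alpha (alpha ^+ s.+2))^T)).
    by rewrite -trmx_mul exprS dmx_mul0 trmx0.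
  rewrite !trmxK (exprS _ s.+1).
  by apply: dmx_exact; rewrite ?expf_neq0 -?exprS ?expr_neq1.
apply/(Ext_coker_shift (B := map_mx f (dmx alpha (alpha ^+ s.+2))^T));
  last exact: IHj.
apply: (mx_exact_map f_inj f_surj); rewrite (exprS _ s.+1).
by apply: dmx_trmx_exact; rewrite -?exprS ?expr_neq1.
Qed.

Lemma d_negE s : d_neg alpha s = map_mx f (dmx alpha (alpha ^+ s)).
Proof.
apply/matrixP => i j; rewrite !mxE.
have E1 : f (model_v alpha) = residue alpha 'X_(@Ordinal 4 0 isT).
  by rewrite -model_residue_gen.
have E2 : f (model_x alpha) = residue alpha 'X_(@Ordinal 4 1 isT).
  by rewrite -model_residue_gen.
have E3 : f (model_y alpha) = residue alpha 'X_(@Ordinal 4 2 isT).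
  by rewrite -model_residue_gen.
have E4 : f (model_z alpha) = residue alpha 'X_(@Ordinal 4 3 isT).
  by rewrite -model_residue_gen.
case: ifP => _; case: ifP => _; rewrite ?rmorphM ?E1 ?E2 ?E3 ?E4 //.
by rewrite -mul_mpolyC rmorphM /= -E2 model_residueC.
Qed.

End ExtM.


Theorem theorem1p7 (k : fieldType) (alpha : k)
    (hk : ~ algebraic_over_finite_field k) (halpha : infinite_order alpha)
    (s : nat) (hs : (1 <= s)%N) (i : int) (hi : i != 0) :
  (TR i (M_ alpha s) <-> i < s%:Z) /\
  (forall T : lmodType (ringR alpha), is_transpose T (M_ alpha s) ->
     (TR i T <-> - s%:Z < i)).
Proof.
have ExtM j : Ext_eq0 (M_ alpha s) (ringR alpha)^o j.+1 <-> (j.+1 < s)%N.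
  by rewrite /M_ d_negE; apply: Ext_coker_dmx.
have ExtT j T : is_transpose T (M_ alpha s) ->
    Ext_eq0 T (ringR alpha)^o j.+1.
  case=> m [n [A [AM AT]]]; apply: Ext_iso (lmod_iso_sym AT) _.
  apply: Ext_coker_trmx (lmod_iso_sym AM) _.
  by rewrite d_negE -(prednK hs); apply: Ext_coker_dmx_trmx.
split=> [|T TM]; case: i hi => [[//|j]|j] _ /=.
- by rewrite ExtM ltz_nat.
- by split=> [_|_ T]; [lia | apply: ExtT].
- by split=> [_|_]; [lia | apply: ExtT].
split=> [TR_T|lt_js].
  suff /TR_T/ExtM : is_transpose (M_ alpha s) T by lia.
  by have [m [n [A [AM AT]]]] := TM; exists n, m, A^T; rewrite trmxK.
move=> T' [p [q [B [BT BT']]]]; apply: Ext_iso (lmod_iso_sym BT') _.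
have [m [n [A [AM AT]]]] := TM.
apply: Ext_coker_trmx (lmod_iso_trans AT (lmod_iso_sym BT)) _.
by rewrite trmxK; apply: (Ext_iso AM); apply/ExtM; lia.
Qed.
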